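(* Let $\chi:\mathbb{Z}\to\mathbb{C}$ be a periodic function of period $m\ge1$ with $\chi(0)=0$, and let $n\ge 0$ be an integer. Then \begin{align*} \hat S_{n,0}(\chi)=\;&(-1)^{n+1}n!\int_0^{+\infty}\frac{1}{t^n}\left(\frac{F_\chi(-t,-1)}{t}-\sum_{k=-1}^{n}b_{\chi,k}t^k\right)\frac{e^{-t}\,dt}{t}\\ &-(-1)^{n+1}n!\sum_{j=0}^{n+1}\frac{(-1)^{j+1}}{j!}H_j\,b_{\chi,n-j}+(-1)^{n+1}n!\,b_{\chi,n}(1)\log m, \end{align*} where $$F_\chi(t,x)=\sum_{a=1}^{m}\frac{\chi(a)\,t\,e^{at}}{e^{mt}-1}e^{xt},$$ and the coefficients $b_{\chi,k}$, $k\ge-1$, are defined by $\dfrac{F_\chi(-t,-1)}{t}=\sum_{k=-1}^{\infty}b_{\chi,k}t^k$.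
   Context: $H_j$ is the $j$-th harmonic number ($H_0=0$). The constant $\hat S_{n,0}(\chi)$ is the constant term (coefficient of $s^0$) in the asymptotic expansion, as the integer $s\to+\infty$, of $$\sum_{k=1}^{ms}\chi(k)\,k^n\log k$$ in the family of functions $s^j\log s$ ($j\ge0$) and $s^j$ ($j\in\mathbb{Z}$); this expansion exists and is unique. The twisted Bernoulli polynomials $b_{\chi,k}(w)$ are defined by $\frac1tF_\chi(-t,w-1)=\sum_{k\ge-1}b_{\chi,k}(w)t^k$, so that $b_{\chi,k}=b_{\chi,k}(0)$ and $b_{\chi,n}(1)$ is the coefficient of $t^n$ in $\frac1tF_\chi(-t,0)$. *)

(* Defs.v *)
From Stdlib Require Import Reals ZArith.
From Coquelicot Require Import Coquelicot.

Open Scope R_scope.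

(** [C] carries several module structures in Coquelicot: convergence of series
    and integrals of functions of a real variable are taken in
    [C_R_CompleteNormedModule] (that is [C] over [R]), and [iota] is
    Coquelicot's definite description, the one behind [RInt_gen]. *)

Definition harmonic (j : nat) : R := sum_n_m (fun i => / INR i) 1 j.

(** Only real arguments occur in the integral; at [t = 0] the value is the junk
    value coming from [/ 0], so the function is only used at [t <> 0]. *)
Definition F_chi (m : nat) (chi : Z -> C) (t x : R) : C :=
  sum_n_m (fun a : nat =>
    (chi (Z.of_nat a)
       * RtoC (t * exp (INR a * t) / (exp (INR m * t) - 1) * exp (x * t)))%C)
    1 m.

(** [f t = sum_(k >= -1) beta k * t ^ k] on a punctured neighbourhood of [0];
    the values of [beta] below [-1] are irrelevant. *)
Definition is_laurent (f : R -> C) (beta : Z -> C) : Prop :=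
  exists r : posreal, forall t : R, 0 < Rabs t < r ->
    @is_series R_AbsRing C_R_NormedModule
      (fun i : nat =>
         (beta (Z.of_nat i - 1)%Z * RtoC (powerRZ t (Z.of_nat i - 1)))%C)
      (f t).

Definition laurent_coef (f : R -> C) (k : Z) : C :=
  @iota C_R_CompleteNormedModule
    (fun c : C => exists beta : Z -> C, is_laurent f beta /\ c = beta k).

(** [b_{chi,k}(w)], at real [w] and for [k >= -1]; [b_{chi,k}] is the value at
    [w = 0]. *)
Definition b_chi (m : nat) (chi : Z -> C) (k : Z) (w : R) : C :=
  laurent_coef (fun t : R => (F_chi m chi (- t) (w - 1) / RtoC t)%C) k.

(** Asymptotic expansion of [u s], as [s -> +oo], in the family [s ^ j * ln s]
    ([j >= 0], coefficients [alpha j]) and [s ^ j] ([j] in [Z], coefficients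
    [gamma j]).  All coefficients of index larger than some [J] vanish, and for
    every [N] the terms of the expansion not negligible with respect to
    [s ^ (- N)] approximate [u s] up to [o(s ^ (- N))].  Since all the terms
    with a logarithm dominate [s ^ 0], none is ever dropped; the truncations at
    the larger scale functions follow from these ones. *)
Definition is_asymptotic_expansion
    (u : nat -> C) (alpha : nat -> C) (gamma : Z -> C) : Prop :=
  exists J : nat,
    (forall j : nat, (J < j)%nat -> alpha j = RtoC 0) /\
    (forall j : Z, (Z.of_nat J < j)%Z -> gamma j = RtoC 0) /\
    forall N : nat,
      @is_domin nat R_AbsRing R_AbsRing R_NormedModule C_R_NormedModule
        eventually
        (fun s : nat => powerRZ (INR s) (- Z.of_nat N))
        (fun s : nat =>
           (u s
            - sum_n (fun j : nat => alpha j * RtoC (INR s ^ j * ln (INR s))) J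
            - sum_n (fun i : nat =>
                gamma (Z.of_nat J - Z.of_nat i)%Z
                  * RtoC (powerRZ (INR s) (Z.of_nat J - Z.of_nat i)))
                (J + N))%C).

Definition asymptotic_constant (u : nat -> C) : C :=
  @iota C_R_CompleteNormedModule
    (fun c : C => exists (alpha : nat -> C) (gamma : Z -> C),
       is_asymptotic_expansion u alpha gamma /\ c = gamma 0%Z).

Definition S_hat (n m : nat) (chi : Z -> C) : C :=
  asymptotic_constant (fun s : nat =>
    sum_n_m (fun k : nat =>
      (chi (Z.of_nat k) * RtoC (INR k ^ n * ln (INR k)))%C) 1 (m * s)).

(* Main.v *)
(** Split the sum over [k <= m s] into residue classes [k = x_i = m i + a].
    Put [g t = sum_i exp (- x_i t) = exp (- a t) / (1 - exp (- m t))], so that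
    [F_chi (- t, - 1) / t] is a combination of the functions [exp t * g t].
    Let [A_j x] be the integral over [t > 0] of
    [t ^ (- j - 1) (exp (- x t) - exp (- t) T t)], where [T] is the Taylor
    polynomial of degree [j] of [exp ((1 - x) t)]: Frullani's integral and
    integrations by parts give
    [A_j x = (-1) ^ (j + 1) / j! * x ^ j ln x + polynomial].
    The truncated sum of the exponentials is [g t - exp (- m s t) g t]; inserting
    it in the regularised integral of order [n] expresses
    [sum_(i < s) x_i ^ n ln x_i], up to a polynomial in [s] vanishing at [0], as
    the integral [I] of the theorem minus the regularised integral of
    [exp (- m s t) g t].  Expanding [g] at [0], the latter is a combination of
    the explicit [A_j (m s)], [j <= n + 1], and of a Laplace integral whose
    expansion (Watson's lemma) only has negative powers of [s].  The constant
    term is then read off the polynomial parts. *)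
Require Import Defs.
From Stdlib Require Import Reals ZArith Lra Lia.
From Coquelicot Require Import Coquelicot.

(** * Cauchy products *)

(** [S_hat] and [b_chi] are definite descriptions, so expansions in powers and logarithms, and
    Laurent series, need uniqueness besides existence. No limit is taken under the integral: the
    regularised integral does not depend on [s], and computing it for every [s] gives an exact
    identity each of whose terms has a known expansion. The analysis is real, for one residue class;
    the values of [chi] enter linearly at the end.

    Two families of Laurent coefficients occur: [p] of [exp t * g t], giving b_{chi,k}, which
    regularise the integral, and [q] of [g], giving b_{chi,k}(1), which come from expanding
    [exp (- m s t) g t]. The constant [ln m] comes from A_0 (m s) = - ln (m s) alone, hence stands
    with a [q]. The other constants, 1 / (j * j!) for j >= 1, also stand with [q]; passing to [p]
    multiplies their generating series by exp (- t), and this product has the coefficients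
    (-1)^(j+1) H_j / j!, the source of the harmonic numbers. *)

Definition exp_coef (c : R) (k : nat) : R := c ^ k / INR (fact k).

(** The exclusive bound admits the empty sum, which [sum_n] does not, so that inductions on a
    truncation order can start at 0. *)
Fixpoint psum (f : nat -> R) (n : nat) : R :=
  match n with O => 0 | S n' => psum f n' + f n' end.

Lemma psum_ext f g n : (forall k, (k < n)%nat -> f k = g k) -> psum f n = psum g n.
Proof.
  induction n as [|n IH]; intros H; simpl; [reflexivity|].
  rewrite IH by (intros; apply H; lia). rewrite H by lia. reflexivity.
Qed.

Lemma psum_plus f g n : psum (fun k => f k + g k) n = psum f n + psum g n.
Proof. induction n as [|n IH]; simpl; [ring|rewrite IH; ring]. Qed.

Lemma psum_scal c f n : psum (fun k => c * f k) n = c * psum f n.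
Proof. induction n as [|n IH]; simpl; [ring|rewrite IH; ring]. Qed.

Lemma psum_minus f g n : psum (fun k => f k - g k) n = psum f n - psum g n.
Proof. induction n as [|n IH]; simpl; [ring|rewrite IH; ring]. Qed.

Lemma psum_sum_n (f : nat -> R) n : sum_n f n = psum f (S n).
Proof.
  induction n as [|n IH].
  - rewrite sum_O. simpl. ring.
  - rewrite sum_Sn, IH. reflexivity.
Qed.

Lemma psum_add f n k : psum f (n + k) = psum f n + psum (fun i => f (n + i)%nat) k.
Proof.
  induction k as [|k IH]; simpl.
  - rewrite Nat.add_0_r. ring.
  - rewrite Nat.add_succ_r. simpl. rewrite IH. ring.
Qed.

Lemma psum_rev f n : psum f n = psum (fun k => f (n - 1 - k)%nat) n.
Proof.
  induction n as [|n IH]; [reflexivity|].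
  replace (S n) with (1 + n)%nat at 2 by lia. rewrite psum_add. simpl psum.
  replace (n - 0 - 0)%nat with n by lia. rewrite IH, Rplus_comm.
  f_equal; [ring|]. apply psum_ext. intros k Hk. f_equal. lia.
Qed.

Lemma PS_mult_psum a b n :
  PS_mult a b n = psum (fun k => a k * b (n - k)%nat) (S n).
Proof.
  unfold PS_mult. rewrite <- psum_sum_n, sum_n_Reals. reflexivity.
Qed.

Lemma PS_mult_0 a b : PS_mult a b 0 = a 0%nat * b 0%nat.
Proof. reflexivity. Qed.

Lemma PS_mult_S a b n :
  PS_mult a b (S n) = a 0%nat * b (S n) + PS_mult (fun k => a (S k)) b n.
Proof.
  rewrite !PS_mult_psum. replace (S (S n)) with (1 + S n)%nat by lia.
  rewrite psum_add. simpl. ring.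
Qed.

Lemma PS_mult_ext a a' b b' n :
  (forall k, (k <= n)%nat -> a k = a' k) ->
  (forall k, (k <= n)%nat -> b k = b' k) ->
  PS_mult a b n = PS_mult a' b' n.
Proof.
  intros Ha Hb. rewrite !PS_mult_psum. apply psum_ext.
  intros k Hk. rewrite Ha, Hb by lia. reflexivity.
Qed.

Lemma PS_mult_plus_l a a' b n :
  PS_mult (fun k => a k + a' k) b n = PS_mult a b n + PS_mult a' b n.
Proof.
  rewrite !PS_mult_psum, <- psum_plus. apply psum_ext. intros; ring.
Qed.

Lemma PS_mult_plus_r a b b' n :
  PS_mult a (fun k => b k + b' k) n = PS_mult a b n + PS_mult a b' n.
Proof.
  rewrite !PS_mult_psum, <- psum_plus. apply psum_ext. intros; ring.
Qed.

Lemma PS_mult_scal_l c a b n :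
  PS_mult (fun k => c * a k) b n = c * PS_mult a b n.
Proof.
  rewrite !PS_mult_psum, <- psum_scal. apply psum_ext. intros; ring.
Qed.

Lemma PS_mult_scal_r c a b n :
  PS_mult a (fun k => c * b k) n = c * PS_mult a b n.
Proof.
  rewrite !PS_mult_psum, <- psum_scal. apply psum_ext. intros; ring.
Qed.

Lemma PS_mult_comm a b n : PS_mult a b n = PS_mult b a n.
Proof.
  rewrite !PS_mult_psum, psum_rev. apply psum_ext. intros k Hk.
  replace (S n - 1 - k)%nat with (n - k)%nat by lia.
  replace (n - (n - k))%nat with k by lia. ring.
Qed.

(** Peeling off the first coefficient of [a] replaces [a] by its shift, so the induction keeps [a]
    general. *)
Lemma PS_mult_assoc a b c n :
  PS_mult (PS_mult a b) c n = PS_mult a (PS_mult b c) n.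
Proof.
  revert a; induction n as [|n IH]; intros a.
  - rewrite !PS_mult_0. ring.
  - rewrite PS_mult_S.
    rewrite (PS_mult_ext (fun k => PS_mult a b (S k))
               (fun k => a 0%nat * b (S k) + PS_mult (fun i => a (S i)) b k) c c)
      by (intros; first [reflexivity | apply PS_mult_S]).
    rewrite PS_mult_plus_l, IH, PS_mult_scal_l, PS_mult_0.
    rewrite (PS_mult_S a), (PS_mult_S b). ring.
Qed.

Lemma PS_mult_one_r a n :
  PS_mult a (fun k => match k with O => 1 | S _ => 0 end) n = a n.
Proof.
  revert a; induction n as [|n IH]; intros a.
  - rewrite PS_mult_0. ring.
  - rewrite PS_mult_S, IH. ring.
Qed.

(** Leibniz rule for the operator t d/dt, read on coefficients. *)
Lemma PS_mult_euler a b n :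
  INR n * PS_mult a b n =
  PS_mult (fun k => INR k * a k) b n + PS_mult a (fun k => INR k * b k) n.
Proof.
  rewrite !PS_mult_psum, <- psum_scal, <- psum_plus. apply psum_ext.
  intros k Hk. replace (INR n) with (INR k + INR (n - k)) at 1; [ring|].
  rewrite <- plus_INR. f_equal. lia.
Qed.

Lemma exp_coef_mult u v n :
  PS_mult (exp_coef u) (exp_coef v) n = exp_coef (u + v) n.
Proof.
  unfold exp_coef at 3. rewrite binomial. unfold PS_mult, Rdiv.
  rewrite Rmult_comm, scal_sum. apply sum_eq. intros i Hi.
  unfold exp_coef, Binomial.C. field.
  repeat split; apply INR_fact_neq_0.
Qed.

Lemma exp_coef_S c k : INR (S k) * exp_coef c (S k) = c * exp_coef c k.
Proof.
  unfold exp_coef. rewrite fact_simpl, mult_INR. simpl pow. field.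
  split; [apply INR_fact_neq_0 | apply not_0_INR; lia].
Qed.

Lemma harmonic_S j : harmonic (S j) = harmonic j + / INR (S j).
Proof. unfold harmonic. rewrite sum_n_Sm by lia. reflexivity. Qed.

Lemma harmonic_0 : harmonic 0 = 0.
Proof. unfold harmonic. rewrite sum_n_m_zero by lia. reflexivity. Qed.

(** The operator t d/dt turns the series of t^j / (j * j!) into exp t - 1. Applied to the product y
    of this series with exp (- t), it gives t y' = - t y + 1 - exp (- t), a recursion on
    coefficients whose solution is a signed H_n / n!. *)
Lemma exp_coef_mult_recip_index (kap : nat -> R) :
  kap 0%nat = 0 -> (forall j, kap (S j) = / (INR (S j) * INR (fact (S j)))) ->
  forall n, PS_mult (exp_coef (-1)) kap n
            = (-1) ^ (n + 1) / INR (fact n) * harmonic n.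
Proof.
  intros H0 HS n. induction n as [|n IH].
  - rewrite PS_mult_0, H0, harmonic_0. ring.
  - assert (Hn : INR (S n) <> 0) by (apply not_0_INR; lia).
    assert (Hf := INR_fact_neq_0 n).
    apply (Rmult_eq_reg_l (INR (S n))); [|exact Hn].
    rewrite PS_mult_euler.
    rewrite (PS_mult_S (fun k => INR k * exp_coef (-1) k)). simpl (INR 0).
    rewrite (PS_mult_ext (fun k => INR (S k) * exp_coef (-1) (S k))
               (fun k => -1 * exp_coef (-1) k) kap kap)
      by (intros; first [reflexivity | apply exp_coef_S]).
    rewrite PS_mult_scal_l, IH.
    rewrite (PS_mult_ext (exp_coef (-1)) (exp_coef (-1))
       (fun k => INR k * kap k)
       (fun k => exp_coef 1 k + -1 * (match k with O => 1 | S _ => 0 end))).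
    2: reflexivity.
    2: { intros [|k] _.
         - rewrite H0. unfold exp_coef. simpl. field.
         - rewrite HS. unfold exp_coef. rewrite pow1. field.
           split; [apply INR_fact_neq_0 | apply not_0_INR; lia]. }
    rewrite PS_mult_plus_r, PS_mult_scal_r, PS_mult_one_r, exp_coef_mult.
    unfold exp_coef. replace (-1 + 1) with 0 by ring.
    rewrite harmonic_S, fact_simpl, mult_INR, !Nat.add_1_r. simpl pow.
    field. auto using INR_fact_neq_0.
Qed.

(** * Polynomial functions *)

(** Horner form of a polynomial function of degree less than [d]. No coefficient list is carried
    along; the constant term is simply [f 0]. *)
Fixpoint poly_lt (d : nat) (f : R -> R) : Prop :=
  match d with
  | O => forall x, f x = 0
  | S d' => exists c g, poly_lt d' g /\ forall x, f x = c + x * g x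
  end.

Lemma poly_lt_ext d f g : (forall x, f x = g x) -> poly_lt d f -> poly_lt d g.
Proof.
  destruct d; simpl.
  - intros E H x. rewrite <- E. apply H.
  - intros E (c & h & Hh & H). exists c, h. split; [exact Hh|].
    intros x. rewrite <- E. apply H.
Qed.

Lemma poly_lt_S d f : poly_lt d f -> poly_lt (S d) f.
Proof.
  revert f; induction d as [|d IH]; intros f.
  - intros H. exists 0, (fun _ => 0). split; [intros x; reflexivity|].
    intros x. rewrite H. ring.
  - intros (c & g & Hg & H). exists c, g. split; [apply IH, Hg|exact H].
Qed.

Lemma poly_lt_le d d' f : (d <= d')%nat -> poly_lt d f -> poly_lt d' f.
Proof. induction 1; auto using poly_lt_S. Qed.

Lemma poly_lt_plus d f g :
  poly_lt d f -> poly_lt d g -> poly_lt d (fun x => f x + g x).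
Proof.
  revert f g; induction d as [|d IH]; intros f g.
  - simpl. intros Hf Hg x. rewrite Hf, Hg. ring.
  - intros (c & f' & Hf' & Hf) (c' & g' & Hg' & Hg).
    exists (c + c'), (fun x => f' x + g' x). split; [auto|].
    intros x. rewrite Hf, Hg. ring.
Qed.

Lemma poly_lt_scal d k f : poly_lt d f -> poly_lt d (fun x => k * f x).
Proof.
  revert f; induction d as [|d IH]; intros f.
  - simpl. intros Hf x. rewrite Hf. ring.
  - intros (c & f' & Hf' & Hf).
    exists (k * c), (fun x => k * f' x). split; [auto|].
    intros x. rewrite Hf. ring.
Qed.

Lemma poly_lt_mul_id d f : poly_lt d f -> poly_lt (S d) (fun x => x * f x).
Proof. intros H. exists 0, f. split; [exact H|]. intros; ring. Qed.

Lemma poly_lt_mul_affine d u v f :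
  poly_lt d f -> poly_lt (S d) (fun x => (u * x + v) * f x).
Proof.
  intros H. apply poly_lt_ext with (fun x => u * (x * f x) + v * f x);
    [intros; ring|].
  apply poly_lt_plus; [apply poly_lt_scal, poly_lt_mul_id, H|].
  apply poly_lt_S, poly_lt_scal, H.
Qed.

Lemma poly_lt_const c : poly_lt 1 (fun _ => c).
Proof.
  exists c, (fun _ => 0). split; [intros x; reflexivity|]. intros; ring.
Qed.

Lemma poly_lt_affine_pow u v d : poly_lt (S d) (fun x => (u * x + v) ^ d).
Proof.
  induction d as [|d IH]; [exact (poly_lt_const 1)|].
  apply (poly_lt_mul_affine (S d) u v (fun x => (u * x + v) ^ d)), IH.
Qed.

Lemma poly_lt_pow d : poly_lt (S d) (fun x => x ^ d).
Proof.
  apply poly_lt_ext with (fun x => (1 * x + 0) ^ d);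
    [intros; f_equal; ring | apply poly_lt_affine_pow].
Qed.

Lemma poly_lt_comp_affine d u v f :
  poly_lt d f -> poly_lt d (fun x => f (u * x + v)).
Proof.
  revert f; induction d as [|d IH]; intros f.
  - simpl. intros H x. apply H.
  - intros (c & g & Hg & H).
    apply poly_lt_ext with (fun x => c + (u * x + v) * g (u * x + v));
      [intros; symmetry; apply H|].
    apply poly_lt_plus.
    + apply poly_lt_le with 1%nat; [lia|apply poly_lt_const].
    + apply (poly_lt_mul_affine d u v (fun x => g (u * x + v))), IH, Hg.
Qed.

Lemma poly_lt_lead d f :
  poly_lt (S d) f ->
  exists c g, poly_lt d g /\ forall x, f x = c * x ^ d + g x.
Proof.
  revert f; induction d as [|d IH]; intros f (c & g & Hg & H).
  - exists c, (fun _ => 0). split; [intros x; reflexivity|].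
    intros x. rewrite H, Hg. simpl. ring.
  - destruct (IH g Hg) as (k & h & Hh & E).
    exists k, (fun x => c + x * h x). split.
    + exists c, h. split; [exact Hh|reflexivity].
    + intros x. rewrite H, E. simpl. ring.
Qed.

Lemma poly_lt_pow_diff d :
  exists r, poly_lt d r /\
    forall x, (x + 1) ^ S d - x ^ S d = INR (S d) * x ^ d + r x.
Proof.
  induction d as [|d (r & Hr & E)].
  - exists (fun _ => 0). split; [intros x; reflexivity|]. intros; simpl; ring.
  - exists (fun x => INR (S d) * x ^ d + (1 * x + 1) * r x). split.
    + apply poly_lt_plus; [apply poly_lt_scal, poly_lt_pow|].
      apply poly_lt_mul_affine, Hr.
    + intros x.
      replace ((x + 1) ^ S (S d) - x ^ S (S d))
        with ((x + 1) * ((x + 1) ^ S d - x ^ S d) + x ^ S d) by (simpl; ring).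
      rewrite E, (S_INR (S d)). simpl pow. ring.
Qed.

(** A leading term c x^d is the difference of c x^(d+1) / (d+1) up to lower degree, and the
    induction absorbs the rest. The normalisation [F 0 = 0] is what later keeps such sums out of the
    constant term. *)
Lemma poly_lt_antidiff d f :
  poly_lt d f ->
  exists F, poly_lt (S d) F /\ F 0 = 0 /\ forall x, F (x + 1) - F x = f x.
Proof.
  revert f; induction d as [|d IH]; intros f Hf.
  - exists (fun _ => 0). split; [apply poly_lt_const|]. split; [reflexivity|].
    intros x. rewrite Hf. ring.
  - destruct (poly_lt_lead d f Hf) as (c & g & Hg & E).
    destruct (poly_lt_pow_diff d) as (r & Hr & Er).
    set (k := c / INR (S d)).
    destruct (IH (fun x => g x + - k * r x)) as (F & HF & HF0 & EF).
    { apply poly_lt_plus; [exact Hg|apply poly_lt_scal, Hr]. }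
    exists (fun x => k * x ^ S d + F x). split; [|split].
    + apply poly_lt_plus; [apply poly_lt_scal, poly_lt_pow|apply poly_lt_S, HF].
    + rewrite HF0. simpl. ring.
    + intros x. rewrite E.
      replace (k * (x + 1) ^ S d + F (x + 1) - (k * x ^ S d + F x))
        with (k * ((x + 1) ^ S d - x ^ S d) + (F (x + 1) - F x)) by ring.
      rewrite Er, EF. unfold k. field. apply not_0_INR; lia.
Qed.

Lemma poly_lt_psum d u v f :
  poly_lt d f ->
  exists F, poly_lt (S d) F /\ F 0 = 0 /\
    forall s : nat, psum (fun k => f (u * INR k + v)) s = F (INR s).
Proof.
  intros Hf.
  destruct (poly_lt_antidiff d (fun x => f (u * x + v))) as (F & HF & HF0 & E).
  { apply poly_lt_comp_affine, Hf. }
  exists F. split; [exact HF|]. split; [exact HF0|].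
  induction s as [|s IH].
  - simpl. symmetry; exact HF0.
  - simpl psum. rewrite IH, <- (E (INR s)), S_INR. ring.
Qed.

(** * Asymptotic expansions *)

(** The coefficient of [s ^ (J - i)] is [g i]. *)
Definition expands (J : nat) (u : nat -> C) (c : C) : Prop :=
  exists al g : nat -> C, g J = c /\ forall N : nat,
    @is_domin nat R_AbsRing R_AbsRing R_NormedModule C_R_NormedModule
      eventually
      (fun s : nat => powerRZ (INR s) (- Z.of_nat N))
      (fun s : nat =>
         (u s
          - sum_n (fun j : nat => al j * RtoC (INR s ^ j * ln (INR s))) J
          - sum_n (fun i : nat =>
              g i * RtoC (powerRZ (INR s) (Z.of_nat J - Z.of_nat i)))
              (J + N))%C).

Ltac Cring := match goal with |- ?a = ?b => change (@eq C a b); ring end.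

Lemma sum_n_Cplus (f g : nat -> C) n :
  sum_n (fun k => f k + g k)%C n = (sum_n f n + sum_n g n)%C.
Proof. apply (sum_n_plus (G := C_AbelianMonoid) f g n). Qed.

Lemma sum_n_Cmult (c : C) (f : nat -> C) n :
  sum_n (fun k => c * f k)%C n = (c * sum_n f n)%C.
Proof. apply (sum_n_mult_l (K := C_Ring) c f n). Qed.

Lemma sum_n_C0 n : sum_n (fun _ => RtoC 0) n = RtoC 0.
Proof. apply (sum_n_m_const_zero (G := C_AbelianMonoid)). Qed.

Lemma sum_n_Cdelta (i0 : nat) (f : nat -> C) n :
  (i0 <= n)%nat ->
  sum_n (fun i => (if Nat.eqb i i0 then RtoC 1 else RtoC 0) * f i)%C n = f i0.
Proof.
  intros H.
  assert (H0 : forall k, (k < i0)%nat ->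
    sum_n (fun i => (if Nat.eqb i i0 then RtoC 1 else RtoC 0) * f i)%C k = RtoC 0).
  { intros k Hk. transitivity (sum_n (fun _ : nat => RtoC 0) k); [|apply sum_n_C0].
    apply sum_n_ext_loc. intros i Hi.
    destruct (Nat.eqb_spec i i0); [lia|Cring]. }
  induction H as [|n H IH].
  - destruct i0 as [|i0]; [rewrite sum_O; apply (Cmult_1_l (f 0%nat))|].
    rewrite sum_Sn, H0, Nat.eqb_refl by lia. change plus with Cplus. Cring.
  - rewrite sum_Sn, IH. destruct (Nat.eqb_spec (S n) i0); [lia|].
    change plus with Cplus. Cring.
Qed.

Lemma expands_ext J u v c :
  (forall s, (1 <= s)%nat -> u s = v s) -> expands J u c -> expands J v c.
Proof.
  intros E (al & g & Hg & H). exists al, g. split; [exact Hg|].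
  intros N eps. generalize (H N eps). intros [s0 Hs0].
  exists (S s0). intros s Hs. rewrite <- E by lia. apply Hs0. lia.
Qed.

Lemma expands_plus J u v c d :
  expands J u c -> expands J v d -> expands J (fun s => u s + v s)%C (c + d)%C.
Proof.
  intros (al & g & Hg & H) (al' & g' & Hg' & H').
  exists (fun j => al j + al' j)%C, (fun j => g j + g' j)%C.
  split; [rewrite Hg, Hg'; reflexivity|]. intros N.
  generalize (domin_plus _ _ _ (H N) (H' N)). intros D eps.
  generalize (D eps). apply filter_imp. intros s Hs.
  eapply Rle_trans; [|exact Hs]. apply Req_le. f_equal.
  change (@plus C_R_NormedModule) with Cplus.
  rewrite (sum_n_ext (fun j => (al j + al' j) * RtoC (INR s ^ j * ln (INR s)))%C
     (fun j => al j * RtoC (INR s ^ j * ln (INR s))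
               + al' j * RtoC (INR s ^ j * ln (INR s)))%C) by (intros; Cring).
  rewrite (sum_n_ext
     (fun i => (g i + g' i) * RtoC (powerRZ (INR s) (Z.of_nat J - Z.of_nat i)))%C
     (fun i => g i * RtoC (powerRZ (INR s) (Z.of_nat J - Z.of_nat i))
       + g' i * RtoC (powerRZ (INR s) (Z.of_nat J - Z.of_nat i)))%C)
    by (intros; Cring).
  rewrite !sum_n_Cplus. Cring.
Qed.

Lemma norm_C_R (z : C) : @norm R_AbsRing C_R_NormedModule z = Cmod z.
Proof. symmetry. exact (Cmod_norm z). Qed.

Lemma is_linear_Cmult (k : C) :
  @is_linear R_AbsRing C_R_NormedModule C_R_NormedModule (Cmult k).
Proof.
  split.
  - intros x y. change (k * (x + y) = k * x + k * y)%C. ring.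
  - intros r x. rewrite !scal_R_Cmult. Cring.
  - exists (Cmod k + 1). split; [generalize (Cmod_ge_0 k); lra|].
    intros x. rewrite !norm_C_R, Cmod_mult.
    apply Rmult_le_compat_r; [apply Cmod_ge_0|lra].
Qed.

Lemma is_linear_RtoC :
  @is_linear R_AbsRing R_NormedModule C_R_NormedModule RtoC.
Proof.
  split.
  - intros x y. apply RtoC_plus.
  - intros r x. rewrite scal_R_Cmult. apply RtoC_mult.
  - exists 1. split; [lra|].
    intros x. rewrite norm_C_R, Cmod_R. change (norm x) with (Rabs x). lra.
Qed.

Lemma expands_scal J k u c :
  expands J u c -> expands J (fun s => k * u s)%C (k * c)%C.
Proof.
  intros (al & g & Hg & H).
  exists (fun j => k * al j)%C, (fun j => k * g j)%C.
  split; [rewrite Hg; reflexivity|]. intros N.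
  generalize (is_domin_linear _ _ _ (is_linear_Cmult k) (H N)). intros D eps.
  generalize (D eps). apply filter_imp. intros s Hs.
  eapply Rle_trans; [|exact Hs]. apply Req_le. f_equal.
  rewrite (sum_n_ext (fun j => (k * al j) * RtoC (INR s ^ j * ln (INR s)))%C
     (fun j => k * (al j * RtoC (INR s ^ j * ln (INR s))))%C) by (intros; Cring).
  rewrite (sum_n_ext
     (fun i => (k * g i) * RtoC (powerRZ (INR s) (Z.of_nat J - Z.of_nat i)))%C
     (fun i => k * (g i * RtoC (powerRZ (INR s) (Z.of_nat J - Z.of_nat i))))%C)
    by (intros; Cring).
  rewrite !sum_n_Cmult. Cring.
Qed.

(** Covers functions equal to a finite combination of the scale: the remainder is zero at every
    truncation order. *)
Lemma expands_exact J u al g :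
  (forall s, (1 <= s)%nat -> forall N, u s =
     (sum_n (fun j : nat => al j * RtoC (INR s ^ j * ln (INR s))) J
      + sum_n (fun i : nat =>
              g i * RtoC (powerRZ (INR s) (Z.of_nat J - Z.of_nat i)))
              (J + N))%C) ->
  expands J u (g J).
Proof.
  intros E. exists al, g. split; [reflexivity|]. intros N eps.
  exists 1%nat. intros s Hs. rewrite (E s Hs N) at 1.
  match goal with |- norm ?x <= _ => replace x with (@zero C_R_NormedModule) end.
  - rewrite norm_zero. apply Rmult_le_pos; [apply Rlt_le, cond_pos|apply norm_ge_0].
  - change (@zero C_R_NormedModule) with (RtoC 0). Cring.
Qed.

Lemma expands_log J j :
  (j <= J)%nat -> expands J (fun s => RtoC (INR s ^ j * ln (INR s))) 0%C.
Proof.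
  intros Hj.
  apply (expands_exact J _ (fun i => if Nat.eqb i j then RtoC 1 else RtoC 0)
           (fun _ => RtoC 0)).
  intros s _ N. rewrite (sum_n_Cdelta j) by exact Hj.
  rewrite sum_n_Cmult. ring.
Qed.

Lemma expands_pow J j :
  (j <= J)%nat ->
  expands J (fun s => RtoC (INR s ^ j)) (if Nat.eqb j 0 then 1 else 0)%C.
Proof.
  intros Hj.
  replace (if Nat.eqb j 0 then RtoC 1 else RtoC 0)
    with (if Nat.eqb J (J - j) then RtoC 1 else RtoC 0).
  2:{ destruct (Nat.eqb_spec J (J - j)), (Nat.eqb_spec j 0); auto; lia. }
  apply (expands_exact J _ (fun _ => RtoC 0)
     (fun i => if Nat.eqb i (J - j) then RtoC 1 else RtoC 0)).
  intros s _ N. rewrite (sum_n_Cdelta (J - j)) by lia.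
  rewrite sum_n_Cmult.
  replace (Z.of_nat J - Z.of_nat (J - j))%Z with (Z.of_nat j) by lia.
  rewrite <- pow_powerRZ. ring.
Qed.

(** The factor s^k makes the induction on the Horner form work: c + x g splits s^k f into c s^k and
    s^(k+1) g, and only k = 0 reaches the constant term. *)
Lemma expands_poly J d k f :
  poly_lt d f -> (k + d <= S J)%nat ->
  expands J (fun s => RtoC (INR s ^ k * f (INR s)))
    (if Nat.eqb k 0 then RtoC (f 0) else 0)%C.
Proof.
  revert k f; induction d as [|d IH]; intros k f Hf Hk.
  - replace (if Nat.eqb k 0 then RtoC (f 0) else 0%C) with (RtoC 0)
      by (rewrite Hf; destruct (Nat.eqb k 0); reflexivity).
    apply (expands_exact J _ (fun _ => RtoC 0) (fun _ => RtoC 0)).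
    intros s _ N. rewrite !sum_n_Cmult, Hf, Rmult_0_r. ring.
  - destruct Hf as (c & g & Hg & E).
    apply expands_ext with
      (fun s => RtoC c * RtoC (INR s ^ k) + RtoC (INR s ^ S k * g (INR s)))%C.
    { intros s _. rewrite E, <- RtoC_mult, <- RtoC_plus. f_equal. simpl. ring. }
    replace (if Nat.eqb k 0 then RtoC (f 0) else 0%C)
      with (RtoC c * (if Nat.eqb k 0 then 1 else 0) + 0)%C.
    + apply expands_plus.
      * apply expands_scal, expands_pow. lia.
      * apply (IH (S k) g Hg). lia.
    + rewrite E. destruct (Nat.eqb k 0); [|ring].
      replace (c + 0 * g 0) with c by ring. ring.
Qed.

Lemma expands_poly_0 J f :
  poly_lt (S J) f -> expands J (fun s => RtoC (f (INR s))) (RtoC (f 0)).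
Proof.
  intros H. generalize (expands_poly J (S J) 0 f H (Nat.le_refl _)).
  apply expands_ext. intros. f_equal. simpl. ring.
Qed.

(** An error O(s^(-L-1)) after [L] terms is o(s^(-L)), as the definition of an expansion asks; the
    powers are all negative, hence the constant 0. *)
Lemma expands_tail J (W : nat -> R) (d : nat -> R) :
  (forall L, exists K, forall s, (1 <= s)%nat ->
     Rabs (W s - psum (fun l => d l / INR s ^ S l) L) <= K / INR s ^ S L) ->
  expands J (fun s => RtoC (W s)) 0%C.
Proof.
  intros H.
  set (g := fun i => if Nat.leb i J then RtoC 0 else RtoC (d (i - J - 1)%nat)).
  exists (fun _ => RtoC 0), g. split.
  { unfold g. rewrite Nat.leb_refl. reflexivity. }
  intros N.
  assert (E : forall s, (1 <= s)%nat -> sum_n (fun i : nat =>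
      (g i * RtoC (powerRZ (INR s) (Z.of_nat J - Z.of_nat i)))%C) (J + N)
      = RtoC (psum (fun l => d l / INR s ^ S l) N)).
  { intros s Hs. induction N as [|N IH].
    - rewrite Nat.add_0_r. simpl. transitivity (sum_n (fun _ : nat => RtoC 0) J); [|apply sum_n_C0].
      apply sum_n_ext_loc. intros i Hi. unfold g.
      rewrite (proj2 (Nat.leb_le i J) Hi). Cring.
    - rewrite Nat.add_succ_r, sum_Sn, IH. change plus with Cplus.
      simpl psum. rewrite RtoC_plus. f_equal. unfold g.
      rewrite (proj2 (Nat.leb_gt _ J)) by lia.
      rewrite <- RtoC_mult. f_equal. unfold Rdiv. f_equal; [f_equal; lia|].
      replace (Z.of_nat J - Z.of_nat (S (J + N)))%Z with (- Z.of_nat (S N))%Z by lia.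
      rewrite powerRZ_neg', <- pow_powerRZ. reflexivity. }
  intros eps. destruct (H N) as [K HK].
  (* Beyond |K| / eps the spare factor 1/s brings the error below eps s^(-N). *)
  destruct (nfloor_ex (Rabs K / eps)) as [s0 Hs0].
  { apply Rmult_le_pos; [apply Rabs_pos|]. apply Rlt_le, Rinv_0_lt_compat, cond_pos. }
  exists (S s0). intros s Hs.
  assert (Hs1 : (1 <= s)%nat) by lia.
  rewrite E by exact Hs1.
  assert (Hpos : 0 < INR s) by (apply lt_0_INR; lia).
  assert (HsK : Rabs K <= eps * INR s).
  { assert (Rabs K / eps < INR s).
    { apply Rlt_le_trans with (INR s0 + 1); [apply Hs0|].
      rewrite <- S_INR. apply le_INR, Hs. }
    apply Rlt_le. apply (Rmult_lt_compat_l eps) in H0; [|apply cond_pos].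
    eapply Rle_lt_trans; [|exact H0]. apply Req_le. field.
    apply Rgt_not_eq, cond_pos. }
  rewrite sum_n_Cmult.
  replace (RtoC (W s) - RtoC 0 * sum_n (fun j => RtoC (INR s ^ j * ln (INR s))) J
     - RtoC (psum (fun l => d l / INR s ^ S l)%R N))%C
    with (RtoC (W s - psum (fun l => d l / INR s ^ S l) N))
    by (rewrite RtoC_minus; ring).
  rewrite norm_C_R, Cmod_R. eapply Rle_trans; [apply HK, Hs1|].
  rewrite powerRZ_neg', <- pow_powerRZ.
  change (norm ?x) with (Rabs x). rewrite Rabs_right.
  2:{ apply Rle_ge, Rlt_le, Rinv_0_lt_compat, pow_lt, Hpos. }
  simpl pow. unfold Rdiv. rewrite Rinv_mult.
  apply Rle_trans with (Rabs K * / INR s * / INR s ^ N).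
  - rewrite <- Rmult_assoc. apply Rmult_le_compat_r.
    { apply Rlt_le, Rinv_0_lt_compat, pow_lt, Hpos. }
    apply Rmult_le_compat_r; [apply Rlt_le, Rinv_0_lt_compat, Hpos|apply Rle_abs].
  - apply Rmult_le_compat_r.
    { apply Rlt_le, Rinv_0_lt_compat, pow_lt, Hpos. }
    apply Rmult_le_reg_r with (INR s); [exact Hpos|].
    rewrite Rmult_assoc, Rinv_l, Rmult_1_r by lra. exact HsK.
Qed.

(** * Uniqueness of the constant term of an expansion *)

Lemma Rabs_div_pow_le x s d : (1 <= s)%nat -> Rabs (x * / INR s ^ d) <= Rabs x.
Proof.
  intros Hs. rewrite Rabs_mult.
  assert (1 <= INR s ^ d) by (apply pow_R1_Rle; apply (le_INR 1); lia).
  rewrite (Rabs_right (/ _)) by (apply Rle_ge, Rlt_le, Rinv_0_lt_compat; lra).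
  apply Rle_trans with (Rabs x * 1); [|lra].
  apply Rmult_le_compat_l; [apply Rabs_pos|].
  rewrite <- Rinv_1. apply Rinv_le_contravar; lra.
Qed.

(** The degree of [p] is below [d], so p(s) / s^d is O(1/s) and the hypothesis on w(s) / s suffices.
    It is used with w = ln and w = 1. *)
Lemma is_lim_seq_poly_lt (w : nat -> R) d p :
  is_lim_seq (fun s => w s / INR s) 0 -> poly_lt d p ->
  is_lim_seq (fun s => p (INR s) * w s / INR s ^ d) 0.
Proof.
  intros Hw. revert p; induction d as [|d IH]; intros p Hp.
  - apply is_lim_seq_ext with (fun _ => 0); [|apply is_lim_seq_const].
    intros s. rewrite Hp. unfold Rdiv. ring.
  - destruct Hp as (c & g & Hg & E).
    apply is_lim_seq_ext_loc with
      (fun s => c * (w s / INR s * / INR s ^ d) + g (INR s) * w s / INR s ^ d).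
    { exists 1%nat. intros s Hs. rewrite E. simpl pow. field.
      assert (INR s <> 0) by (apply not_0_INR; lia).
      split; [apply pow_nonzero|]; assumption. }
    replace (Finite 0) with (Rbar_plus (c * 0) 0) by (simpl; f_equal; ring).
    apply is_lim_seq_plus'; [|apply IH, Hg].
    apply (is_lim_seq_scal_l _ c 0).
    apply is_lim_seq_abs_0.
    apply is_lim_seq_le_le_loc with (fun _ => 0) (fun s => Rabs (w s / INR s)).
    + exists 1%nat. intros s Hs. split; [apply Rabs_pos|].
      apply Rabs_div_pow_le, Hs.
    + apply is_lim_seq_const.
    + replace (Finite 0) with (Rbar_abs 0) by (simpl; f_equal; apply Rabs_R0).
      apply is_lim_seq_abs, Hw.
Qed.

Lemma is_lim_seq_ln_div : is_lim_seq (fun s => ln (INR s) / INR s) 0.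
Proof.
  apply (filterlim_comp _ _ _ INR (fun x => ln x / x) _ (Rbar_locally p_infty)).
  - apply is_lim_seq_INR.
  - apply is_lim_div_ln_p.
Qed.

Lemma is_lim_seq_inv_ln : is_lim_seq (fun s => / ln (INR s)) 0.
Proof.
  apply (is_lim_seq_inv _ p_infty); [|discriminate].
  apply (filterlim_comp _ _ _ INR ln _ (Rbar_locally p_infty)).
  - apply is_lim_seq_INR.
  - apply is_lim_ln_p.
Qed.

(** Division by the top power s^d leaves c ln s + k + o(1), with c and k the leading coefficients.
    Dividing further by ln s gives c = 0, then k = 0 follows, and the degree drops. *)
Lemma poly_log_lim_0 d p q :
  poly_lt d p -> poly_lt d q ->
  is_lim_seq (fun s => p (INR s) * ln (INR s) + q (INR s)) 0 ->
  forall x, p x = 0 /\ q x = 0.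
Proof.
  revert p q; induction d as [|d IH]; intros p q Hp Hq HE; [intros x; auto|].
  destruct (poly_lt_lead d p Hp) as (c & p1 & Hp1 & Ep).
  destruct (poly_lt_lead d q Hq) as (k & q1 & Hq1 & Eq).
  set (E := fun s => p (INR s) * ln (INR s) + q (INR s)) in HE.
  assert (HEd : is_lim_seq (fun s => E s / INR s ^ d) 0).
  { apply is_lim_seq_abs_0.
    apply is_lim_seq_le_le_loc with (fun _ => 0) (fun s => Rabs (E s)).
    - exists 1%nat. intros s Hs. split; [apply Rabs_pos|].
      apply Rabs_div_pow_le, Hs.
    - apply is_lim_seq_const.
    - replace (Finite 0) with (Rbar_abs 0) by (simpl; f_equal; apply Rabs_R0).
      apply is_lim_seq_abs, HE. }
  assert (Hone : is_lim_seq (fun s => 1 / INR s) 0).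
  { apply is_lim_seq_ext with (fun s => / INR s);
      [intros; unfold Rdiv; ring|].
    apply (is_lim_seq_inv _ p_infty); [apply is_lim_seq_INR|discriminate]. }
  assert (Hp1l := is_lim_seq_poly_lt _ d p1 is_lim_seq_ln_div Hp1).
  assert (Hp1o := is_lim_seq_poly_lt _ d p1 Hone Hp1).
  assert (Hq1o := is_lim_seq_poly_lt _ d q1 Hone Hq1).
  assert (Hc : c = 0).
  { assert (is_lim_seq (fun _ => c) 0).
    { apply is_lim_seq_ext_loc with (fun s =>
        (E s / INR s ^ d - q1 (INR s) * 1 / INR s ^ d - k) * / ln (INR s)
        - p1 (INR s) * 1 / INR s ^ d).
      - exists 2%nat. intros s Hs. unfold E. rewrite Ep, Eq. field.
        assert (1 < INR s) by (apply (lt_INR 1); lia).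
        split; [apply pow_nonzero; lra|].
        apply Rgt_not_eq. rewrite <- ln_1. apply ln_increasing; lra.
      - replace (Finite 0) with (Finite ((0 - 0 - k) * 0 - 0)) by (f_equal; ring).
        apply is_lim_seq_minus'; [|exact Hp1o].
        apply is_lim_seq_mult'; [|apply is_lim_seq_inv_ln].
        apply is_lim_seq_minus'; [|apply is_lim_seq_const].
        apply is_lim_seq_minus'; assumption. }
    apply is_lim_seq_unique in H. rewrite Lim_seq_const in H.
    injection H; auto. }
  assert (Hk : k = 0).
  { assert (is_lim_seq (fun _ => k) 0).
    { apply is_lim_seq_ext_loc with (fun s =>
        E s / INR s ^ d - q1 (INR s) * 1 / INR s ^ d
        - p1 (INR s) * ln (INR s) / INR s ^ d).
      - exists 1%nat. intros s Hs. unfold E. rewrite Ep, Eq, Hc. field.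
        apply pow_nonzero, not_0_INR. lia.
      - replace (Finite 0) with (Finite (0 - 0 - 0)) by (f_equal; ring).
        apply is_lim_seq_minus'; [apply is_lim_seq_minus'|]; assumption. }
    apply is_lim_seq_unique in H. rewrite Lim_seq_const in H.
    injection H; auto. }
  intros x. rewrite Ep, Eq, Hc, Hk.
  replace (0 * x ^ d) with 0 by ring. rewrite !Rplus_0_l.
  apply (IH p1 q1 Hp1 Hq1).
  apply is_lim_seq_ext with E; [|exact HE].
  intros s. unfold E. rewrite Ep, Eq, Hc, Hk. ring.
Qed.

Lemma poly_lt_psum_pow (c : nat -> R) (e : nat -> nat) d n :
  (forall i, (i < n)%nat -> (e i < d)%nat) ->
  poly_lt d (fun x => psum (fun i => c i * x ^ e i) n).
Proof.
  induction n as [|n IH]; intros H; simpl.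
  - apply poly_lt_le with 0%nat; [lia|]. intros x; reflexivity.
  - apply poly_lt_plus; [apply IH; intros; apply H; lia|].
    apply poly_lt_scal, poly_lt_le with (S (e n)); [apply H; lia|apply poly_lt_pow].
Qed.

(** The real and imaginary parts are the two instances of [phi]. *)
Lemma asymptotic_expansion_real_part (phi : C -> R)
    (phi_plus : forall z w, phi (z + w)%C = phi z + phi w)
    (phi_scal : forall z r, phi (z * RtoC r)%C = phi z * r)
    (phi_le : forall z, Rabs (phi z) <= Cmod z)
    (u : nat -> C) (al : nat -> C) (ga : Z -> C) :
  is_asymptotic_expansion u al ga ->
  exists d p q, poly_lt d p /\ poly_lt d q /\ q 0 = phi (ga 0%Z) /\
    is_lim_seq (fun s => phi (u s) - (p (INR s) * ln (INR s) + q (INR s))) 0.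
Proof.
  intros (J & _ & _ & H). exists (S J).
  assert (Hsum : forall (f : nat -> C) n,
    phi (sum_n f n) = psum (fun i => phi (f i)) (S n)).
  { intros f n. induction n as [|n IH].
    - rewrite sum_O. simpl. ring.
    - rewrite sum_Sn. change plus with Cplus. rewrite phi_plus, IH. reflexivity. }
  exists (fun x => psum (fun j => phi (al j) * x ^ j) (S J)).
  exists (fun x => psum (fun i =>
    phi (ga (Z.of_nat J - Z.of_nat i)%Z) * x ^ (J - i)) (S J)).
  split; [apply poly_lt_psum_pow; auto|].
  split; [apply poly_lt_psum_pow; intros; lia|].
  split.
  { simpl. rewrite Nat.sub_diag, Z.sub_diag, (psum_ext _ (fun _ => 0 * 0)).
    - rewrite psum_scal. simpl. ring.
    - intros i Hi. replace (J - i)%nat with (S (J - i - 1)) by lia. simpl. ring. }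
  apply is_lim_seq_spec. intros eps.
  (* At order N = 0 the truncation keeps exactly s^J, ..., s^0, so the power part is a polynomial
     and the error is o(1). Halving [eps] turns the large inequality into a strict one. *)
  destruct (H 0%nat (pos_div_2 eps)) as [s0 Hs0].
  exists (S s0). intros s Hs. rewrite Rminus_0_r.
  specialize (Hs0 s ltac:(lia)). rewrite norm_C_R in Hs0.
  replace (powerRZ (INR s) (- Z.of_nat 0)) with 1 in Hs0 by reflexivity.
  change (norm 1) with (Rabs 1) in Hs0. rewrite Rabs_R1, Rmult_1_r in Hs0.
  assert (He := cond_pos eps). simpl in Hs0.
  eapply Rle_lt_trans; [|apply (Rlt_eps2_eps eps He)].
  eapply Rle_trans; [|exact Hs0].
  eapply Rle_trans; [|apply phi_le]. apply Req_le. f_equal.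
  assert (phi_minus : forall z w, phi (z - w)%C = phi z - phi w).
  { intros z w. replace (z - w)%C with (z + w * RtoC (-1))%C
      by (destruct z, w; apply injective_projections; simpl; ring).
    rewrite phi_plus, phi_scal. ring. }
  rewrite !phi_minus, !Hsum, Nat.add_0_r.
  unfold Rminus. rewrite Rplus_assoc. f_equal.
  rewrite Ropp_plus_distr. f_equal; f_equal.
  - rewrite Rmult_comm, <- psum_scal. apply psum_ext. intros j _.
    rewrite phi_scal. ring.
  - apply psum_ext. intros i Hi. rewrite phi_scal. f_equal.
    replace (Z.of_nat J - Z.of_nat i)%Z with (Z.of_nat (J - i)) by lia.
    apply pow_powerRZ.
Qed.

Lemma asymptotic_constant_unique u al ga al' ga' :
  is_asymptotic_expansion u al ga -> is_asymptotic_expansion u al' ga' ->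
  ga 0%Z = ga' 0%Z.
Proof.
  intros H H'.
  assert (K : forall phi : C -> R,
    (forall z w, phi (z + w)%C = phi z + phi w) ->
    (forall z r, phi (z * RtoC r)%C = phi z * r) ->
    (forall z, Rabs (phi z) <= Cmod z) -> phi (ga 0%Z) = phi (ga' 0%Z)).
  { intros phi h1 h2 h3.
    destruct (asymptotic_expansion_real_part phi h1 h2 h3 _ _ _ H)
      as (d & p & q & Hp & Hq & <- & L).
    destruct (asymptotic_expansion_real_part phi h1 h2 h3 _ _ _ H')
      as (d' & p' & q' & Hp' & Hq' & <- & L').
    assert (X : forall x, p' x + -1 * p x = 0 /\ q' x + -1 * q x = 0).
    { apply (poly_log_lim_0 (Nat.max d d')).
      - apply poly_lt_plus; [|apply poly_lt_scal];
          (eapply poly_lt_le; [|eassumption]; lia).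
      - apply poly_lt_plus; [|apply poly_lt_scal];
          (eapply poly_lt_le; [|eassumption]; lia).
      - generalize (is_lim_seq_minus' _ _ _ _ L L'). rewrite Rminus_0_r.
        apply is_lim_seq_ext. intros s. ring. }
    destruct (X 0) as [_ X0]. lra. }
  apply injective_projections; apply K.
  - reflexivity.
  - intros [x y] r. simpl. ring.
  - intros z; eapply Rle_trans; [apply Rmax_l|apply Rmax_Cmod].
  - reflexivity.
  - intros [x y] r. simpl. ring.
  - intros z; eapply Rle_trans; [apply Rmax_r|apply Rmax_Cmod].
Qed.

Lemma asymptotic_constant_eq J u c :
  expands J u c -> asymptotic_constant u = c.
Proof.
  intros (al & g & Hg & H).
  (* [expands] says nothing about coefficients above [J], whereas [is_asymptotic_expansion] wants
     them to vanish; they are cut off here. *)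
  set (al' := fun j => if Nat.leb j J then al j else RtoC 0).
  set (ga := fun j : Z => if Z.leb j (Z.of_nat J)
                          then g (Z.to_nat (Z.of_nat J - j)) else RtoC 0).
  assert (A : is_asymptotic_expansion u al' ga).
  { exists J. split; [|split].
    - intros j Hj. unfold al'. rewrite (proj2 (Nat.leb_gt j J)) by lia. reflexivity.
    - intros j Hj. unfold ga. rewrite (proj2 (Z.leb_gt j _)) by lia. reflexivity.
    - intros N eps. generalize (H N eps). apply filter_imp. intros s Hs.
      eapply Rle_trans; [|exact Hs]. apply Req_le. f_equal.
      unfold Cminus. f_equal; [f_equal|]; apply (f_equal Copp).
      + apply sum_n_ext_loc. intros j Hj. unfold al'.
        rewrite (proj2 (Nat.leb_le j J)) by lia. reflexivity.
      + apply sum_n_ext. intros i. unfold ga.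
        rewrite (proj2 (Z.leb_le _ (Z.of_nat J))) by lia. do 2 f_equal. lia. }
  assert (E : ga 0%Z = c).
  { unfold ga. rewrite (proj2 (Z.leb_le _ _)) by lia.
    rewrite Z.sub_0_r, Nat2Z.id. exact Hg. }
  unfold asymptotic_constant. apply (iota_unique (V := C_R_CompleteNormedModule)).
  - intros y (al2 & ga2 & H2 & ->). rewrite <- E.
    exact (asymptotic_constant_unique _ _ _ _ _ H2 A).
  - exists al', ga. split; [exact A|]. symmetry; exact E.
Qed.

(** * Power series at the origin *)

Ltac to_R := match goal with |- ?a = ?b => change (@eq R a b) end.

(** The neighbourhood is punctured because the functions in question, such as t / (1 - exp (- M t)),
    have a meaningless value at 0. *)
Definition has_pseries (a : nat -> R) (f : R -> R) : Prop :=
  exists r : posreal, forall t, 0 < Rabs t < r -> is_pseries a t (f t).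

Lemma CV_radius_gt a (r : R) :
  (forall t, 0 < Rabs t < r -> ex_pseries a t) ->
  forall t, Rabs t < r -> Rbar_lt (Rabs t) (CV_radius a).
Proof.
  (* Were the radius below this intermediate point, the terms at [y] would not tend to 0, although
     the series converges there. *)
  intros H t Ht. set (y := (Rabs t + r) / 2).
  assert (Hy : Rabs t < y < r) by (unfold y; lra).
  assert (H0 := Rabs_pos t).
  assert (Ay : Rabs y = y) by (apply Rabs_right; lra).
  apply Rbar_lt_le_trans with (Finite y); [apply Hy|].
  apply Rbar_not_lt_le. intros C. rewrite <- Ay in C.
  apply (CV_disk_outside a y) in C. apply C.
  apply (ex_series_lim_0 (fun n => a n * y ^ n)), (proj1 (ex_pseries_R a y)).
  apply H. rewrite Ay. lra.
Qed.

Lemma has_pseries_radius a f :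
  has_pseries a f ->
  exists r : posreal, forall t, Rabs t < r -> Rbar_lt (Rabs t) (CV_radius a).
Proof.
  intros [r H]. exists r. apply CV_radius_gt.
  intros t Ht. exists (f t). apply H, Ht.
Qed.

Lemma has_pseries_radius_pos a f : has_pseries a f -> Rbar_lt 0 (CV_radius a).
Proof.
  intros H. destruct (has_pseries_radius _ _ H) as [r Hr].
  rewrite <- Rabs_R0. apply Hr. rewrite Rabs_R0. apply cond_pos.
Qed.

Lemma has_pseries_ext a f g :
  (forall t, t <> 0 -> f t = g t) -> has_pseries a f -> has_pseries a g.
Proof.
  intros E [r H]. exists r. intros t Ht. rewrite <- E; [apply H, Ht|].
  intros ->. rewrite Rabs_R0 in Ht. lra.
Qed.

Lemma has_pseries_coef_ext a b f :
  (forall n, a n = b n) -> has_pseries a f -> has_pseries b f.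
Proof.
  intros E [r H]. exists r. intros t Ht.
  apply (is_pseries_ext a); [exact E|apply H, Ht].
Qed.

Lemma posreal_min3 (r1 r2 r3 : posreal) :
  exists r : posreal, r <= r1 /\ r <= r2 /\ r <= r3.
Proof.
  exists (mkposreal _ (Rmin_stable_in_posreal (mkposreal _ (Rmin_stable_in_posreal r1 r2)) r3)).
  simpl. generalize (Rmin_l (Rmin r1 r2) r3) (Rmin_r (Rmin r1 r2) r3)
    (Rmin_l r1 r2) (Rmin_r r1 r2). lra.
Qed.

Lemma has_pseries_mult a b f g :
  has_pseries a f -> has_pseries b g ->
  has_pseries (PS_mult a b) (fun t => f t * g t).
Proof.
  intros Ha Hb.
  destruct (has_pseries_radius _ _ Ha) as [ra Ra], (has_pseries_radius _ _ Hb) as [rb Rb].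
  destruct Ha as [r1 H1], Hb as [r2 H2].
  destruct (posreal_min3 r1 r2 ra) as (r & h1 & h2 & h3).
  destruct (posreal_min3 r rb rb) as (r' & h4 & h5 & _).
  exists r'. intros t Ht.
  apply is_pseries_mult; [apply H1|apply H2|apply Ra|apply Rb]; lra.
Qed.

Lemma has_pseries_plus a b f g :
  has_pseries a f -> has_pseries b g ->
  has_pseries (fun n => a n + b n) (fun t => f t + g t).
Proof.
  intros [r1 H1] [r2 H2]. destruct (posreal_min3 r1 r2 r2) as (r & h1 & h2 & _).
  exists r. intros t Ht.
  apply (is_pseries_plus a b t (f t) (g t)); [apply H1|apply H2]; lra.
Qed.

Lemma has_pseries_mul_id a f :
  has_pseries a f -> has_pseries (PS_incr_1 a) (fun t => t * f t).
Proof.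
  intros [r H]. exists r. intros t Ht. apply (is_pseries_incr_1 a t (f t)), H, Ht.
Qed.

Lemma has_pseries_scal k a f :
  has_pseries a f -> has_pseries (fun n => k * a n) (fun t => k * f t).
Proof.
  intros [r H]. exists r. intros t Ht.
  apply (is_pseries_scal k a t (f t)); [apply Rmult_comm|apply H, Ht].
Qed.

Lemma has_pseries_exp c : has_pseries (exp_coef c) (fun t => exp (c * t)).
Proof.
  exists (mkposreal 1 Rlt_0_1). intros t _. apply is_pseries_R.
  generalize (proj1 (is_pseries_R _ _ _) (is_exp_Reals (c * t))).
  apply is_series_ext. intros n. unfold exp_coef. rewrite Rpow_mult_distr.
  to_R. field. apply INR_fact_neq_0.
Qed.

(** Multiplying by [t] makes the values of the two series at [0] agree
    although nothing is known about [f 0]. *)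
Lemma has_pseries_unique a b f :
  has_pseries a f -> has_pseries b f -> forall n, a n = b n.
Proof.
  intros Ha Hb n.
  apply (PSeries_ext_recip (PS_incr_1 a) (PS_incr_1 b) (S n)).
  - rewrite CV_radius_incr_1. apply (has_pseries_radius_pos _ _ Ha).
  - rewrite CV_radius_incr_1. apply (has_pseries_radius_pos _ _ Hb).
  - destruct Ha as [r1 H1], Hb as [r2 H2].
    destruct (posreal_min3 r1 r2 r2) as (r & h1 & h2 & _).
    exists r. intros t Ht. rewrite !PSeries_incr_1.
    change (ball 0 r t) with (Rabs (t - 0) < r) in Ht.
    rewrite Rminus_0_r in Ht.
    destruct (Req_dec t 0) as [->|Hn]; [ring|].
    assert (Hp := Rabs_pos_lt t Hn).
    rewrite (is_pseries_unique _ _ _ (H1 t ltac:(lra))).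
    rewrite (is_pseries_unique _ _ _ (H2 t ltac:(lra))). reflexivity.
Qed.

Lemma has_pseries_bounded a f :
  has_pseries a f ->
  exists (K : R) (r : posreal), forall t, 0 < Rabs t < r -> Rabs (f t) <= K.
Proof.
  intros Ha. assert (Hc : continuity_pt (PSeries a) 0).
  { apply PSeries_continuity. rewrite Rabs_R0.
    apply (has_pseries_radius_pos _ _ Ha). }
  destruct Ha as [r1 H1].
  destruct (proj1 (continuity_pt_locally (PSeries a) 0) Hc (mkposreal 1 Rlt_0_1)) as [r2 H2]. simpl in H2.
  destruct (posreal_min3 r1 r2 r2) as (r & h1 & h2 & _).
  exists (Rabs (PSeries a 0) + 1), r. intros t Ht.
  rewrite <- (is_pseries_unique _ _ _ (H1 t ltac:(lra))).
  assert (Hb : ball 0 r2 t).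
  { change (Rabs (t - 0) < r2). rewrite Rminus_0_r. lra. }
  specialize (H2 t Hb).
  generalize (Rabs_triang_inv (PSeries a t) (PSeries a 0)). lra.
Qed.

Lemma has_pseries_decr_1 a f :
  has_pseries a f -> has_pseries (fun n => a (S n)) (fun t => (f t - a 0%nat) / t).
Proof.
  intros [r H]. exists r. intros t Ht.
  assert (t <> 0) by (intros ->; rewrite Rabs_R0 in Ht; lra).
  replace ((f t - a 0%nat) / t) with (scal (/ t) (plus (f t) (opp (a 0%nat)))).
  - apply (is_pseries_decr_1 a t (/ t)); [|apply H, Ht].
    change (/ t * t = 1). field; assumption.
  - change (/ t * (f t + - a 0%nat) = (f t - a 0%nat) / t). field; assumption.
Qed.

(** Each induction step applies the previous order to (f t - a_0) / t, whose series is the shifted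
    one. *)
Lemma has_pseries_taylor a f L :
  has_pseries a f ->
  exists (K : R) (r : posreal), forall t, 0 < Rabs t < r ->
    Rabs (f t - psum (fun k => a k * t ^ k) L) <= K * Rabs t ^ L.
Proof.
  revert a f; induction L as [|L IH]; intros a f H.
  - destruct (has_pseries_bounded _ _ H) as (K & r & HK). exists K, r.
    intros t Ht. simpl. rewrite Rminus_0_r, Rmult_1_r. apply HK, Ht.
  - destruct (IH _ _ (has_pseries_decr_1 _ _ H)) as (K & r & HK). exists K, r.
    intros t Ht. specialize (HK t Ht).
    assert (t <> 0) by (intros ->; rewrite Rabs_R0 in Ht; lra).
    replace (f t - psum (fun k => a k * t ^ k) (S L))
      with (t * ((f t - a 0%nat) / t - psum (fun k => a (S k) * t ^ k) L)).
    + rewrite Rabs_mult. simpl pow.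
      replace (K * (Rabs t * Rabs t ^ L)) with (Rabs t * (K * Rabs t ^ L)) by ring.
      apply Rmult_le_compat_l; [apply Rabs_pos|exact HK].
    + replace (S L) with (1 + L)%nat by lia. rewrite psum_add.
      rewrite (psum_ext (fun i => a (1 + i)%nat * t ^ (1 + i))
                 (fun i => t * (a (S i) * t ^ i))) by (intros; simpl; ring).
      rewrite psum_scal. simpl. field; assumption.
Qed.

(** Each coefficient of the reciprocal series depends on all the earlier ones, so the recursion
    builds a whole table; its entries are meaningful up to index [n]. The constant coefficient of
    [a] is taken to be 1. *)
Fixpoint recip_table (a : nat -> R) (n : nat) : nat -> R :=
  match n with
  | O => fun _ => 1
  | S n' => fun k => if Nat.leb k n' then recip_table a n' k
                     else - PS_mult (fun i => a (S i)) (recip_table a n') n'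
  end.

Definition recip (a : nat -> R) (n : nat) : R := recip_table a n n.

Lemma recip_table_le a n k : (k <= n)%nat -> recip_table a n k = recip a k.
Proof.
  induction 1 as [|n Hk IH]; [reflexivity|].
  simpl. rewrite (proj2 (Nat.leb_le k n)) by lia. exact IH.
Qed.

Lemma recip_S a n : recip a (S n) = - PS_mult (fun i => a (S i)) (recip a) n.
Proof.
  unfold recip at 1. cbn [recip_table]. rewrite (proj2 (Nat.leb_gt (S n) n)) by lia.
  f_equal. apply PS_mult_ext; [reflexivity|]. intros. apply recip_table_le; lia.
Qed.

Lemma PS_mult_recip a n :
  a 0%nat = 1 -> PS_mult a (recip a) n = match n with O => 1 | S _ => 0 end.
Proof.
  intros H. destruct n as [|n].
  - rewrite PS_mult_0, H. unfold recip. simpl. ring.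
  - rewrite PS_mult_S, H, recip_S. ring.
Qed.

Lemma psum_Rabs f n : Rabs (psum f n) <= psum (fun k => Rabs (f k)) n.
Proof.
  induction n as [|n IH]; simpl; [rewrite Rabs_R0; lra|].
  eapply Rle_trans; [apply Rabs_triang|lra].
Qed.

Lemma psum_le f g n :
  (forall k, (k < n)%nat -> f k <= g k) -> psum f n <= psum g n.
Proof.
  induction n as [|n IH]; intros H; simpl; [lra|].
  apply Rplus_le_compat; [apply IH; intros; apply H; lia|apply H; lia].
Qed.

Lemma psum_half n : psum (fun k => (/ 2) ^ S k) n = 1 - (/ 2) ^ n.
Proof. induction n as [|n IH]; simpl in *; [ring|rewrite IH; field]. Qed.

(** Strong induction: the recursion bounds the next coefficient by 1/2 + 1/4 + ..., a partial sum
    below 1. *)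
Lemma recip_bound a n :
  (forall k, Rabs (a (S k)) <= (/ 2) ^ S k) -> Rabs (recip a n) <= 1.
Proof.
  intros H. induction n as [n IH] using lt_wf_ind. destruct n as [|n].
  - unfold recip. simpl. rewrite Rabs_R1. lra.
  - rewrite recip_S, Rabs_Ropp, PS_mult_psum.
    eapply Rle_trans; [apply psum_Rabs|].
    apply Rle_trans with (psum (fun k => (/ 2) ^ S k) (S n)).
    + apply psum_le. intros k Hk. rewrite Rabs_mult, <- (Rmult_1_r ((/ 2) ^ S k)).
      apply Rmult_le_compat; try apply Rabs_pos; [apply H|apply IH; lia].
    + rewrite psum_half. assert (0 < (/ 2) ^ S n) by (apply pow_lt; lra). lra.
Qed.

Lemma has_pseries_recip a f :
  has_pseries a f -> a 0%nat = 1 ->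
  (forall k, Rabs (a (S k)) <= (/ 2) ^ S k) ->
  has_pseries (recip a) (fun t => / f t).
Proof.
  intros Hf H0 Hb.
  assert (Hr : Rbar_le 1 (CV_radius (recip a))).
  { apply (CV_radius_bounded (recip a)). exists 1. intros n.
    rewrite pow1, Rmult_1_r. apply recip_bound, Hb. }
  assert (Hp : has_pseries (recip a) (PSeries (recip a))).
  { exists (mkposreal 1 Rlt_0_1). intros t Ht. simpl in Ht.
    apply PSeries_correct, CV_radius_inside.
    apply Rbar_lt_le_trans with (Finite 1); [apply Ht|exact Hr]. }
  destruct (has_pseries_mult _ _ _ _ Hf Hp) as [r1 H1].
  destruct Hp as [r2 H2]. destruct (posreal_min3 r1 r2 r2) as (r & h1 & h2 & _).
  exists r. intros t Ht.
  replace (/ f t) with (PSeries (recip a) t); [apply H2; lra|].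
  assert (E : f t * PSeries (recip a) t = 1).
  { rewrite <- (is_pseries_unique _ _ _ (H1 t ltac:(lra))).
    (* The constant series 1 is recognised as that of exp (0 * t), whose sum is known. *)
    rewrite (PSeries_ext _ (exp_coef 0)).
    - rewrite (is_pseries_unique _ _ (exp (0 * t))).
      + rewrite Rmult_0_l. apply exp_0.
      + apply is_pseries_R.
        generalize (proj1 (is_pseries_R _ _ _) (is_exp_Reals (0 * t))).
        apply is_series_ext. intros n. unfold exp_coef. rewrite Rpow_mult_distr.
        to_R. field. apply INR_fact_neq_0.
    - intros n. rewrite PS_mult_recip by exact H0. unfold exp_coef.
      destruct n; simpl; unfold Rdiv; [field|ring]. }
  assert (f t <> 0) by (intros Z; rewrite Z in E; lra).
  apply (Rmult_eq_reg_l (f t)); [|assumption]. rewrite E. field; assumption.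
Qed.

Lemma fact_ge_pow2 k : 2 ^ k <= INR (fact (S k)).
Proof.
  induction k as [|k IH]; [simpl; lra|].
  rewrite fact_simpl, mult_INR. simpl pow.
  apply Rmult_le_compat; [lra|apply pow_le; lra| |exact IH].
  apply (le_INR 2). lia.
Qed.

Lemma has_pseries_dilate M a f :
  M <> 0 -> has_pseries a f ->
  has_pseries (fun n => M ^ n * a n) (fun t => f (M * t)).
Proof.
  intros HM [r H]. assert (HM' := Rabs_pos_lt M HM).
  assert (Hr : 0 < r / Rabs M) by (apply Rdiv_lt_0_compat; [apply cond_pos|exact HM']).
  exists (mkposreal _ Hr). intros t [Ht1 Ht2]. simpl in Ht2.
  assert (Ht : 0 < Rabs (M * t) < r).
  { rewrite Rabs_mult. split; [apply Rmult_lt_0_compat; assumption|].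
    apply (Rmult_lt_compat_l (Rabs M)) in Ht2; [|exact HM'].
    replace (Rabs M * (r / Rabs M)) with (pos r) in Ht2 by (field; lra). exact Ht2. }
  apply is_pseries_R.
  generalize (proj1 (is_pseries_R _ _ _) (H _ Ht)).
  apply is_series_ext. intros n. rewrite Rpow_mult_distr. simpl. to_R. ring.
Qed.

(** Up to scaling the coefficients are Bernoulli numbers, but only their existence is used. The case
    M = 1 inverts (1 - exp (- t)) / t, whose coefficients have size 1 / (k+1)! <= 2^(-k), as
    [recip_bound] requires; a dilation gives general [M]. *)
Lemma has_pseries_bernoulli M :
  0 < M -> exists v, has_pseries v (fun t => t / (1 - exp (- M * t))).
Proof.
  intros HM.
  assert (H1 : has_pseries (fun n => -1 * exp_coef (-1) (S n))
                 (fun t => (1 - exp (- t)) / t)).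
  { generalize (has_pseries_scal (-1) _ _ (has_pseries_decr_1 _ _ (has_pseries_exp (-1)))).
    apply has_pseries_ext. intros t Ht. unfold exp_coef. simpl.
    replace (-1 * t) with (- t) by ring. field; exact Ht. }
  apply has_pseries_recip in H1.
  - apply (has_pseries_dilate M) in H1; [|lra].
    apply (has_pseries_scal (/ M)) in H1.
    exists (fun n => / M * (M ^ n * recip (fun n => -1 * exp_coef (-1) (S n)) n)).
    revert H1. apply has_pseries_ext. intros t Ht.
    replace (- (M * t)) with (- M * t) by ring.
    unfold Rdiv. rewrite Rinv_mult, Rinv_inv. field.
    split; [|lra].
    intros E. assert (Hx : exp (- M * t) = exp 0) by (rewrite exp_0; lra).
    apply exp_inv in Hx. apply Ht. apply (Rmult_eq_reg_l M); lra.
  - unfold exp_coef. simpl. field.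
  - intros k. unfold exp_coef.
    unfold Rdiv. rewrite !Rabs_mult, <- RPow_abs.
    replace (Rabs (-1)) with 1 by (rewrite Rabs_left; lra).
    rewrite pow1, !Rmult_1_l.
    rewrite Rabs_right by (apply Rle_ge, Rlt_le, Rinv_0_lt_compat, INR_fact_lt_0).
    rewrite pow_inv. apply Rinv_le_contravar; [apply pow_lt; lra|].
    apply fact_ge_pow2.
Qed.

(** * Integrals over the positive half-line *)

Definition is_int_pos (f : R -> R) (l : R) : Prop :=
  is_RInt_gen f (at_right 0) (Rbar_locally p_infty) l.

Lemma filter_prod_pos :
  filter_prod (at_right 0) (Rbar_locally p_infty)
    (fun ab : R * R => 0 < fst ab /\ fst ab < snd ab).
Proof.
  apply Filter_prod with (fun a => 0 < a < 1) (fun b => 1 < b).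
  - exists (mkposreal 1 Rlt_0_1). intros y Hy Hy0.
    change (Rabs (y - 0) < 1) in Hy. rewrite Rminus_0_r in Hy.
    apply Rabs_def2 in Hy. lra.
  - exists 1. auto.
  - simpl. intros a b Ha Hb. lra.
Qed.

Lemma is_int_pos_ext f g l :
  (forall t, 0 < t -> f t = g t) -> is_int_pos f l -> is_int_pos g l.
Proof.
  intros E. apply (is_RInt_gen_ext f g l). generalize filter_prod_pos.
  apply filter_imp. intros [a b]; simpl. intros [Ha Hb] x Hx. apply E.
  rewrite Rmin_left in Hx by lra. lra.
Qed.

Lemma is_int_pos_plus f g lf lg :
  is_int_pos f lf -> is_int_pos g lg ->
  is_int_pos (fun t => f t + g t) (lf + lg).
Proof. apply (is_RInt_gen_plus f g lf lg). Qed.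

Lemma is_int_pos_scal k f l :
  is_int_pos f l -> is_int_pos (fun t => k * f t) (k * l).
Proof. apply (is_RInt_gen_scal f k l). Qed.

Lemma is_int_pos_0 : is_int_pos (fun _ => 0) 0.
Proof.
  apply (filterlimi_lim_ext_loc (fun _ => 0)); [|apply filterlim_const].
  generalize filter_prod_pos. apply filter_imp. intros [a b] _. simpl.
  generalize (is_RInt_const (V := R_NormedModule) a b 0).
  change (scal (b - a) 0) with ((b - a) * 0). rewrite Rmult_0_r. exact (fun H => H).
Qed.

Lemma is_int_pos_psum (f : nat -> R -> R) (l : nat -> R) n :
  (forall k, (k < n)%nat -> is_int_pos (f k) (l k)) ->
  is_int_pos (fun t => psum (fun k => f k t) n) (psum l n).
Proof.
  induction n as [|n IH]; intros H; simpl; [apply is_int_pos_0|].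
  apply is_int_pos_plus; [apply IH; intros; apply H; lia|apply H; lia].
Qed.

Lemma RInt_gen_int_pos (f : R -> R) (l : R) :
  is_int_pos f l -> RInt_gen f (at_right 0) (Rbar_locally p_infty) = l.
Proof. exact (is_RInt_gen_unique f l). Qed.

Lemma is_int_pos_unique f l l' : is_int_pos f l -> is_int_pos f l' -> l = l'.
Proof.
  intros H H'. rewrite <- (RInt_gen_int_pos f l H).
  exact (RInt_gen_int_pos f l' H').
Qed.

Lemma filterlim_at_right_0 F l K (r : posreal) :
  (forall t, 0 < t < r -> Rabs (F t - l) <= K * t) ->
  filterlim F (at_right 0) (locally l).
Proof.
  intros H. apply filterlim_locally. intros eps.
  assert (HK := Rabs_pos K). assert (He := cond_pos eps).
  assert (Hd : 0 < eps / (Rabs K + 1)) by (apply Rdiv_lt_0_compat; lra).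
  destruct (posreal_min3 r (mkposreal _ Hd) r) as (d & h1 & h2 & _). simpl in h2.
  exists d. intros t Ht Ht0.
  change (Rabs (t - 0) < d) in Ht. rewrite Rminus_0_r in Ht.
  apply Rabs_def2 in Ht. change (Rabs (F t - l) < eps).
  eapply Rle_lt_trans; [apply H; lra|].
  apply Rle_lt_trans with (Rabs K * t).
  { apply Rmult_le_compat_r; [lra|apply Rle_abs]. }
  apply Rlt_le_trans with ((Rabs K + 1) * (eps / (Rabs K + 1))).
  - apply Rle_lt_trans with (Rabs K * (eps / (Rabs K + 1))).
    + apply Rmult_le_compat_l; lra.
    + apply Rmult_lt_compat_r; lra.
  - apply Req_le. field. lra.
Qed.

Lemma filterlim_p_infty_inv F l K :
  (forall t, 1 <= t -> Rabs (F t - l) <= K / t) ->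
  filterlim F (Rbar_locally p_infty) (locally l).
Proof.
  intros H. apply filterlim_locally. intros eps.
  assert (HK := Rabs_pos K). assert (He := cond_pos eps).
  exists (1 + (Rabs K + 1) / eps). intros t Ht.
  assert (0 < (Rabs K + 1) / eps) by (apply Rdiv_lt_0_compat; lra).
  change (Rabs (F t - l) < eps).
  eapply Rle_lt_trans; [apply H; lra|].
  apply (Rmult_lt_reg_r t); [lra|].
  replace (K / t * t) with K by (field; lra).
  apply Rle_lt_trans with (Rabs K); [apply Rle_abs|].
  apply Rlt_le_trans with (eps * ((Rabs K + 1) / eps)).
  - replace (eps * ((Rabs K + 1) / eps)) with (Rabs K + 1) by (field; lra). lra.
  - apply Rmult_le_compat_l; lra.
Qed.

(** Differentiability of [f] provides the continuity of the derivative of [F], in a form that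
    [auto_derive] settles. *)
Lemma is_int_pos_derive F f la lb :
  (forall t, 0 < t -> is_derive F t (f t)) ->
  (forall t, 0 < t -> ex_derive f t) ->
  filterlim F (at_right 0) (locally la) ->
  filterlim F (Rbar_locally p_infty) (locally lb) ->
  is_int_pos f (lb - la).
Proof.
  intros HF Hf La Lb.
  apply is_int_pos_ext with (Derive F).
  { intros t Ht. apply is_derive_unique, HF, Ht. }
  apply (is_RInt_gen_Derive F la lb); [| |exact La|exact Lb];
    generalize filter_prod_pos; apply filter_imp; intros [a b]; simpl;
    intros [Ha Hb] x Hx; rewrite Rmin_left in Hx by lra.
  - eexists. apply HF. lra.
  - apply continuous_ext_loc with f.
    + assert (Hx0 : 0 < x) by lra. exists (mkposreal x Hx0). intros y Hy.
      change (Rabs (y - x) < x) in Hy. apply Rabs_def2 in Hy.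
      symmetry. apply is_derive_unique, HF. lra.
    + apply (ex_derive_continuous f), Hf. lra.
Qed.

(** Cauchy criterion: changing both endpoints changes the integral of [f] by two end pieces, each
    dominated by the same piece for [h]. *)
Lemma is_int_pos_dominated (f h : R -> R) (H : R) :
  (forall t, 0 < t -> continuous f t) ->
  (forall t, 0 < t -> continuous h t) ->
  (forall t, 0 < t -> Rabs (f t) <= h t) ->
  is_int_pos h H ->
  exists l, is_int_pos f l /\ Rabs l <= H.
Proof.
  intros Cf Ch Hfh HH.
  assert (Xf : forall a b, 0 < a -> 0 < b -> ex_RInt f a b).
  { intros a b Ha Hb. apply (ex_RInt_continuous f). intros z Hz. apply Cf.
    generalize (Rmin_glb_lt a b 0 Ha Hb). lra. }
  assert (Xh : forall a b, 0 < a -> 0 < b -> ex_RInt h a b).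
  { intros a b Ha Hb. apply (ex_RInt_continuous h). intros z Hz. apply Ch.
    generalize (Rmin_glb_lt a b 0 Ha Hb). lra. }
  (* Two endpoints drawn from the same filter come in either order, hence the absolute value on the
     right as well. *)
  assert (Le : forall a b, 0 < a -> 0 < b -> Rabs (RInt f a b) <= Rabs (RInt h a b)).
  { assert (Le0 : forall a b, 0 < a -> a <= b -> Rabs (RInt f a b) <= Rabs (RInt h a b)).
    { intros a b Ha Hab. eapply Rle_trans; [|apply Rle_abs].
      apply (norm_RInt_le f h a b); [exact Hab| | |].
      - intros x Hx. apply Hfh. lra.
      - apply (RInt_correct f), Xf; lra.
      - apply (RInt_correct h), Xh; lra. }
    intros a b Ha Hb. destruct (Rle_dec a b) as [D|D]; [apply Le0; lra|].
    rewrite <- (opp_RInt_swap f) by (apply Xf; lra).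
    rewrite <- (opp_RInt_swap h) by (apply Xh; lra).
    change (@opp R_CompleteNormedModule) with Ropp. rewrite !Rabs_Ropp.
    apply Le0; lra. }
  assert (Chas : forall g : R -> R, (forall a b, 0 < a -> 0 < b -> ex_RInt g a b) ->
    forall a b c, 0 < a -> 0 < b -> 0 < c -> RInt g a b + RInt g b c = RInt g a c).
  { intros g Xg a b c Ha Hb Hc. apply (RInt_Chasles g a b c); apply Xg; assumption. }
  assert (Ex : exists l : R, is_int_pos f l).
  { apply (filterlimi_locally_cauchy (U := R_CompleteSpace)
             (F := filter_prod (at_right 0) (Rbar_locally p_infty))
             (fun ab : R * R => is_RInt f (fst ab) (snd ab))).
    - generalize filter_prod_pos. apply filter_imp. intros [a b]; simpl. intros [Ha Hb].
      split.
      + exists (RInt f a b). apply (RInt_correct f), Xf; lra.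
      + intros y1 y2 H1 H2. rewrite <- (is_RInt_unique _ _ _ _ H1).
        apply (is_RInt_unique _ _ _ _ H2).
    - intros eps.
      assert (He : 0 < eps / 4) by (generalize (cond_pos eps); lra).
      assert (HF : filter_prod (at_right 0) (Rbar_locally p_infty) (fun ab : R * R =>
         (0 < fst ab /\ fst ab < snd ab) /\ Rabs (RInt h (fst ab) (snd ab) - H) < eps / 4)).
      { apply filter_and; [apply filter_prod_pos|].
        generalize (proj1 (filterlimi_locally _ _) HH (mkposreal _ He)).
        apply filter_imp. intros [a b]; simpl. intros (z & Hz & Bz).
        rewrite (is_RInt_unique _ _ _ _ Hz). exact Bz. }
      destruct HF as [Q S HQ HS HQS]. simpl in HQS.
      exists (fun ab => Q (fst ab) /\ S (snd ab)). split.
      { apply Filter_prod with Q S; auto. }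
      intros [a b] [a' b'] [Qa Sb] [Qa' Sb'] u' v' Hu Hv. simpl in *.
      destruct (HQS a b Qa Sb) as [P1 E1], (HQS a' b Qa' Sb) as [P2 E2],
        (HQS a b' Qa Sb') as [P3 E3], (HQS a' b' Qa' Sb') as [P4 E4].
      rewrite <- (is_RInt_unique f a b u' Hu), <- (is_RInt_unique f a' b' v' Hv).
      change (Rabs (RInt f a' b' - RInt f a b) < eps).
      generalize (Chas f Xf a' a b' ltac:(lra) ltac:(lra) ltac:(lra))
        (Chas f Xf a b b' ltac:(lra) ltac:(lra) ltac:(lra))
        (Chas h Xh a' a b ltac:(lra) ltac:(lra) ltac:(lra))
        (Chas h Xh a b b' ltac:(lra) ltac:(lra) ltac:(lra))
        (Le a' a ltac:(lra) ltac:(lra)) (Le b b' ltac:(lra) ltac:(lra)).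
      intros c1 c2 c3 c4 l1 l2.
      replace (RInt f a' b' - RInt f a b) with (RInt f a' a + RInt f b b') by lra.
      eapply Rle_lt_trans; [apply Rabs_triang|].
      (* The piece is a difference of two integrals with the common endpoint [b], both within eps /
         4 of [H]. *)
      assert (Rabs (RInt h a' a) < eps / 2).
      { replace (RInt h a' a) with (RInt h a' b - H - (RInt h a b - H)) by lra.
        unfold Rminus at 1. eapply Rle_lt_trans; [apply Rabs_triang|].
        rewrite Rabs_Ropp. lra. }
      assert (Rabs (RInt h b b') < eps / 2).
      { replace (RInt h b b') with (RInt h a b' - H - (RInt h a b - H)) by lra.
        unfold Rminus at 1. eapply Rle_lt_trans; [apply Rabs_triang|].
        rewrite Rabs_Ropp. lra. }
      lra. }
  destruct Ex as [l Hl]. exists l. split; [exact Hl|].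
  apply (RInt_gen_norm (Fa := at_right 0) (Fb := Rbar_locally p_infty) f h l H);
    [| |exact Hl|exact HH];
    generalize filter_prod_pos; apply filter_imp; intros [a b]; simpl; intros [Ha Hb];
    [lra|].
  intros x Hx. apply Hfh. lra.
Qed.

(** Half of the exponential absorbs one factor [t], by exp y >= 1 + y; the other half is left to the
    induction. *)
Lemma exp_pow_bound q lam :
  0 < lam -> exists K, 0 <= K /\ forall t, 0 < t -> t ^ q * exp (- lam * t) <= K.
Proof.
  revert lam; induction q as [|q IH]; intros lam Hl.
  - exists 1. split; [lra|]. intros t Ht. simpl. rewrite Rmult_1_l, <- exp_0.
    left. apply exp_increasing.
    assert (0 < lam * t) by (apply Rmult_lt_0_compat; lra). lra.
  - destruct (IH (lam / 2) ltac:(lra)) as (K & HK0 & HK).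
    exists (2 / lam * K). assert (0 < 2 / lam) by (apply Rdiv_lt_0_compat; lra).
    split; [apply Rmult_le_pos; lra|].
    intros t Ht.
    replace (t ^ S q * exp (- lam * t))
      with ((t * exp (- (lam / 2) * t)) * (t ^ q * exp (- (lam / 2) * t))).
    2:{ replace (- lam * t) with (- (lam / 2) * t + - (lam / 2) * t) by field.
        rewrite exp_plus. simpl. ring. }
    assert (0 < lam / 2 * t) by (apply Rmult_lt_0_compat; lra).
    apply Rmult_le_compat; [| |  |apply HK, Ht].
    + apply Rmult_le_pos; [lra|left; apply exp_pos].
    + apply Rmult_le_pos; [apply pow_le; lra|left; apply exp_pos].
    + replace (- (lam / 2) * t) with (- (lam / 2 * t)) by ring. rewrite exp_Ropp.
      generalize (exp_ineq1_le (lam / 2 * t)). intros Hx.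
      apply (Rmult_le_reg_r (exp (lam / 2 * t))); [apply exp_pos|].
      rewrite Rmult_assoc, Rinv_l by (apply Rgt_not_eq, exp_pos).
      apply (Rmult_le_reg_l (lam / 2)); [lra|].
      replace (lam / 2 * (2 / lam * exp (lam / 2 * t))) with (exp (lam / 2 * t))
        by (field; lra). lra.
Qed.

Lemma is_int_pos_exp_pow lam q :
  0 < lam ->
  is_int_pos (fun t => t ^ q * exp (- lam * t)) (INR (fact q) / lam ^ S q).
Proof.
  intros Hl. induction q as [|q IH].
  - replace (INR (fact 0) / lam ^ 1) with (0 - - / lam) by (simpl; field; lra).
    apply (is_int_pos_derive (fun t => - / lam * exp (- lam * t))).
    + intros t Ht. auto_derive; [trivial|]. simpl. field. lra.
    + intros t Ht. auto_derive. trivial.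
    + apply (filterlim_filter_le_1 (F := locally 0)); [apply filter_le_within|].
      assert (Hc : continuous (fun t => - / lam * exp (- lam * t)) 0).
      { apply (ex_derive_continuous (fun t => - / lam * exp (- lam * t))).
        auto_derive. trivial. }
      unfold continuous in Hc. rewrite Rmult_0_r, exp_0, Rmult_1_r in Hc.
      exact Hc.
    + destruct (exp_pow_bound 1 lam Hl) as (K & HK0 & HK).
      apply filterlim_p_infty_inv with (/ lam * K). intros t Ht.
      rewrite Rminus_0_r, Rabs_mult, Rabs_Ropp.
      assert (0 < / lam) by (apply Rinv_0_lt_compat, Hl).
      rewrite !Rabs_right by (apply Rle_ge, Rlt_le; first [apply exp_pos|lra]).
      unfold Rdiv. rewrite Rmult_assoc. apply Rmult_le_compat_l; [lra|].
      apply (Rmult_le_reg_r t); [lra|]. rewrite Rmult_assoc, Rinv_l by lra.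
      specialize (HK t ltac:(lra)). simpl in HK. lra.
  - replace (INR (fact (S q)) / lam ^ S (S q))
      with (INR (S q) / lam * (INR (fact q) / lam ^ S q) + (0 - 0)).
    2:{ rewrite fact_simpl, mult_INR. simpl pow. field.
        split; [apply pow_nonzero; lra|lra]. }
    (* Integration by parts: the second summand is the derivative of - t^(q+1) exp (- lam t) / lam,
       which vanishes at both ends. *)
    apply is_int_pos_ext with (fun t =>
       INR (S q) / lam * (t ^ q * exp (- lam * t))
       + (t ^ S q * exp (- lam * t) - INR (S q) / lam * (t ^ q * exp (- lam * t)))).
    { intros; ring. }
    apply is_int_pos_plus; [apply is_int_pos_scal, IH|].
    destruct (exp_pow_bound (S (S q)) lam Hl) as (K & HK0 & HK).
    assert (0 < / lam) by (apply Rinv_0_lt_compat, Hl).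
    apply (is_int_pos_derive (fun t => - / lam * (t ^ S q * exp (- lam * t)))).
    + intros t Ht. auto_derive; [trivial|]. 
      change (match q with O => 1 | S _ => INR q + 1 end) with (INR (S q)).
      simpl. field. lra.
    + intros t Ht. auto_derive. trivial.
    + destruct (exp_pow_bound q lam Hl) as (K' & HK0' & HK').
      apply filterlim_at_right_0 with (/ lam * K') (mkposreal 1 Rlt_0_1).
      intros t [Ht _]. rewrite Rminus_0_r, Rabs_mult, Rabs_Ropp.
      rewrite (Rabs_right (/ lam)) by lra. rewrite Rabs_right.
      * rewrite Rmult_assoc. apply Rmult_le_compat_l; [lra|]. simpl.
        specialize (HK' t Ht). rewrite Rmult_assoc, Rmult_comm.
        apply Rmult_le_compat_r; lra.
      * apply Rle_ge, Rmult_le_pos; [apply pow_le; lra|left; apply exp_pos].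
    + apply filterlim_p_infty_inv with (/ lam * K). intros t Ht.
      rewrite Rminus_0_r, Rabs_mult, Rabs_Ropp.
      rewrite (Rabs_right (/ lam)) by lra. rewrite Rabs_right.
      * unfold Rdiv. rewrite Rmult_assoc. apply Rmult_le_compat_l; [lra|].
        apply (Rmult_le_reg_r t); [lra|].
        rewrite (Rmult_assoc K), Rinv_l by lra.
        specialize (HK t ltac:(lra)). simpl in *. lra.
      * apply Rle_ge, Rmult_le_pos; [apply pow_le; lra|left; apply exp_pos].
Qed.

(** * Regularised exponential integrals *)

Lemma Rabs_RInt_le_const (f : R -> R) a b K :
  0 < a -> 0 < b ->
  (forall t, 0 < t -> continuous f t) ->
  (forall t, Rmin a b <= t -> Rabs (f t) <= K) ->
  Rabs (RInt f a b) <= Rabs (b - a) * K.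
Proof.
  intros Ha Hb Cf HK.
  assert (Xf : forall a b, 0 < a -> 0 < b -> ex_RInt f a b).
  { intros x y Hx Hy. apply (ex_RInt_continuous f). intros z Hz. apply Cf.
    generalize (Rmin_glb_lt x y 0 Hx Hy). lra. }
  destruct (Rle_dec a b) as [D|D].
  - rewrite (Rabs_right (b - a)) by lra.
    apply abs_RInt_le_const; [exact D|apply Xf; assumption|].
    intros t Ht. apply HK. rewrite Rmin_left; lra.
  - rewrite <- (opp_RInt_swap f) by (apply Xf; lra).
    change (@opp R_CompleteNormedModule) with Ropp.
    rewrite Rabs_Ropp, Rabs_minus_sym, (Rabs_right (a - b)) by lra.
    apply abs_RInt_le_const; [lra|apply Xf; assumption|].
    intros t Ht. apply HK. rewrite Rmin_right; lra.
Qed.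

Lemma Rabs_exp_neg_sub_1 y : 0 <= y -> Rabs (exp (- y) - 1) <= y.
Proof.
  intros Hy. generalize (exp_ineq1_le (- y)). intros H.
  assert (exp (- y) <= 1).
  { rewrite <- exp_0. destruct Hy as [Hy| <-]; [|rewrite Ropp_0; lra].
    left. apply exp_increasing. lra. }
  apply Rabs_le. lra.
Qed.

Lemma exp_neg_le_inv y : 0 < y -> exp (- y) <= / y.
Proof.
  intros Hy. rewrite exp_Ropp. apply Rinv_le_contravar; [exact Hy|].
  generalize (exp_ineq1_le y). lra.
Qed.

(** [t -> int_1^x exp (- t v) / v dv = int_t^(x t) exp (- u) / u du]
    is an antiderivative. *)
Lemma frullani_exp x :
  0 < x -> is_int_pos (fun t => (exp (- x * t) - exp (- t)) / t) (- ln x).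
Proof.
  intros Hx. set (f := fun u => exp (- u) / u).
  assert (Cf : forall u, 0 < u -> continuous f u).
  { intros u Hu. apply (ex_derive_continuous f). unfold f. auto_derive. lra. }
  assert (Xf : forall a b, 0 < a -> 0 < b -> ex_RInt f a b).
  { intros a b Ha Hb. apply (ex_RInt_continuous f). intros z Hz. apply Cf.
    generalize (Rmin_glb_lt a b 0 Ha Hb). lra. }
  set (G := fun u => RInt f 1 u).
  assert (DG : forall u, 0 < u -> is_derive G u (f u)).
  { intros u Hu. apply (is_derive_RInt f G 1 u); [|apply Cf, Hu].
    exists (mkposreal u Hu). intros y Hy. change (Rabs (y - u) < u) in Hy.
    apply Rabs_def2 in Hy. apply (RInt_correct f), Xf; lra. }
  set (D := fun t => G (x * t) - G t).
  assert (ED : forall t, 0 < t -> D t = RInt (fun v => exp (- (t * v)) / v) 1 x).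
  { intros t Ht. assert (Hxt : 0 < x * t) by (apply Rmult_lt_0_compat; assumption).
    unfold D, G. rewrite <- (RInt_Chasles f 1 t (x * t)) by (apply Xf; lra).
    change plus with Rplus.
    assert (Ec : forall a b : R, a + b - a = b) by (intros; ring).
    rewrite Ec.
    replace (RInt f t (x * t)) with (RInt f (t * 1 + 0) (t * x + 0))
      by (f_equal; ring).
    rewrite <- (RInt_comp_lin f t 0 1 x).
    - apply RInt_ext. intros v Hv.
      assert (0 < Rmin 1 x) by (apply Rmin_glb_lt; lra).
      unfold f. change (t * (exp (- (t * v + 0)) / (t * v + 0)) = exp (- (t * v)) / v).
      rewrite Rplus_0_r. field. lra.
    - apply Xf; rewrite Rplus_0_r; [lra|rewrite Rmult_comm; lra]. }
  assert (Ch : forall t v, 0 < v -> continuous (fun v => exp (- (t * v)) / v) v).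
  { intros t v Hv. apply (ex_derive_continuous (fun v => exp (- (t * v)) / v)).
    auto_derive. lra. }
  replace (- ln x) with (0 - ln x) by ring.
  apply (is_int_pos_derive D).
  - intros t Ht. assert (Hxt : 0 < x * t) by (apply Rmult_lt_0_compat; assumption).
    replace ((exp (- x * t) - exp (- t)) / t) with (x * f (x * t) - f t).
    + apply (is_derive_minus (fun t => G (x * t)) G t (x * f (x * t)) (f t)).
      * apply (is_derive_comp G (fun t => x * t) t (f (x * t)) x).
        -- apply DG, Hxt.
        -- auto_derive; [trivial|ring].
      * apply DG, Ht.
    + unfold f. replace (- (x * t)) with (- x * t) by ring. field. lra.
  - intros t Ht. auto_derive. lra.
  (* At 0 the limit is the integral of 1/v from 1 to x, that is ln x: the integrands differ by at
     most [t] on an interval of length |x - 1|. *)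
  - apply filterlim_at_right_0 with (Rabs (x - 1)) (mkposreal 1 Rlt_0_1).
    intros t [Ht _]. rewrite ED by exact Ht.
    assert (Hln : RInt (fun v => / v) 1 x = ln x).
    { apply is_RInt_unique. replace (ln x) with (minus (ln x) (ln 1))
        by (change minus with Rminus; rewrite ln_1; apply Rminus_0_r).
      assert (0 < Rmin 1 x) by (apply Rmin_glb_lt; lra).
      apply (is_RInt_derive ln).
      - intros v Hv. auto_derive; [lra|field; lra].
      - intros v Hv. apply (ex_derive_continuous (fun v => / v)). auto_derive. lra. }
    rewrite <- Hln.
    assert (X1 : ex_RInt (fun v => exp (- (t * v)) / v) 1 x).
    { apply (ex_RInt_continuous (fun v => exp (- (t * v)) / v)). intros z Hz. apply Ch.
      assert (0 < Rmin 1 x) by (apply Rmin_glb_lt; lra). lra. }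
    assert (X2 : ex_RInt (fun v => / v) 1 x).
    { apply (ex_RInt_continuous (fun v => / v)). intros z Hz.
      apply (ex_derive_continuous (fun v => / v)). auto_derive.
      assert (0 < Rmin 1 x) by (apply Rmin_glb_lt; lra). lra. }
    change (RInt (fun v => exp (- (t * v)) / v) 1 x - RInt (fun v => / v) 1 x)
      with (minus (RInt (fun v => exp (- (t * v)) / v) 1 x) (RInt (fun v => / v) 1 x)).
    rewrite <- (RInt_minus _ _ _ _ X1 X2).
    apply Rabs_RInt_le_const; [lra|lra| |].
    + intros v Hv.
      apply (ex_derive_continuous (fun v => exp (- (t * v)) / v - / v)). auto_derive. lra.
    + intros v Hv. assert (0 < Rmin 1 x) by (apply Rmin_glb_lt; lra).
      change (Rabs (exp (- (t * v)) / v - / v) <= t).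
      assert (0 < t * v) by (apply Rmult_lt_0_compat; lra).
      replace (exp (- (t * v)) / v - / v) with ((exp (- (t * v)) - 1) * / v)
        by (field; lra).
      assert (0 < / v) by (apply Rinv_0_lt_compat; lra).
      rewrite Rabs_mult, (Rabs_right (/ v)) by lra.
      apply (Rmult_le_reg_r v); [lra|]. rewrite Rmult_assoc, Rinv_l by lra.
      rewrite Rmult_1_r. apply Rabs_exp_neg_sub_1. lra.
  (* At infinity exp (- t v) / v <= 1 / (t v^2) <= 1 / (t mu^2). *)
  - set (mu := Rmin 1 x). assert (Hmu : 0 < mu) by (apply Rmin_glb_lt; lra).
    apply filterlim_p_infty_inv with (Rabs (x - 1) * / (mu * mu)).
    intros t Ht. rewrite Rminus_0_r, ED by lra.
    unfold Rdiv at 2. rewrite Rmult_assoc.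
    apply Rabs_RInt_le_const; [lra|lra|apply Ch|].
    intros v Hv. fold mu in Hv.
    assert (0 < t * v) by (apply Rmult_lt_0_compat; lra).
    assert (0 < / v) by (apply Rinv_0_lt_compat; lra).
    unfold Rdiv. rewrite Rabs_mult, (Rabs_right (/ v)) by lra.
    rewrite Rabs_right by (apply Rle_ge, Rlt_le, exp_pos).
    apply Rle_trans with (/ (t * v) * / v).
    + apply Rmult_le_compat_r; [lra|apply exp_neg_le_inv; assumption].
    + rewrite <- !Rinv_mult. apply Rinv_le_contravar.
      * repeat apply Rmult_lt_0_compat; lra.
      * replace (t * v * v) with (v * v * t) by ring.
        apply Rmult_le_compat_r; [lra|]. apply Rmult_le_compat; lra.
Qed.

Definition exp_taylor (c : R) (n : nat) (t : R) : R :=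
  psum (fun l => exp_coef c l * t ^ l) n.

Lemma is_derive_exp_taylor c n t :
  is_derive (exp_taylor c (S n)) t (c * exp_taylor c n t).
Proof.
  induction n as [|n IH].
  - apply (is_derive_ext (fun _ => exp_coef c 0)).
    { intros s. unfold exp_taylor. simpl. ring. }
    auto_derive; [trivial|]. unfold exp_taylor. simpl. ring.
  - apply (is_derive_ext (fun s => exp_taylor c (S n) s + exp_coef c (S n) * s ^ S n)).
    { reflexivity. }
    replace (c * exp_taylor c (S n) t)
      with (c * exp_taylor c n t + exp_coef c (S n) * (INR (S n) * t ^ n)).
    + apply (is_derive_plus (exp_taylor c (S n)) (fun s => exp_coef c (S n) * s ^ S n));
        [exact IH|].
      auto_derive; [trivial|].
      change (match n with O => 1 | S _ => INR n + 1 end) with (INR (S n)).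
      simpl. ring.
    + unfold exp_taylor. simpl psum. rewrite Rmult_plus_distr_l. f_equal.
      rewrite <- !Rmult_assoc, <- exp_coef_S. ring.
Qed.

(** Since exp (- x t) = exp (- t) exp ((1 - x) t), the bracket is exp (- t) times a Taylor remainder
    O(t^(j+1)), so the function is bounded near 0, while the factor exp (- t) makes the subtracted
    polynomial integrable at infinity. *)
Definition reg_exp (j : nat) (x t : R) : R :=
  / t ^ S j * (exp (- x * t) - exp (- t) * exp_taylor (1 - x) (S j) t).

(** Integrating [reg_exp (S j)] by parts gives the recursion; [reg_value j x] is
    the integral of [reg_exp j x]. *)
Fixpoint reg_poly (j : nat) (x : R) : R :=
  match j with
  | O => 0
  | S i => / INR (S i) * (- x * reg_poly i x + exp_coef (1 - x) (S i))
  end.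

Definition reg_value (j : nat) (x : R) : R :=
  (-1) ^ (j + 1) / INR (fact j) * (x ^ j * ln x) + reg_poly j x.

Lemma reg_value_S j x :
  reg_value (S j) x =
  / INR (S j) * (- x * reg_value j x + exp_coef (1 - x) (S j)).
Proof.
  unfold reg_value. cbn [reg_poly]. rewrite fact_simpl, mult_INR, !Nat.add_1_r.
  cbn [pow]. field.
  split; [apply INR_fact_neq_0|apply not_0_INR; lia].
Qed.

Lemma exp_taylor_decay c n :
  exists K, forall t, 1 <= t -> Rabs (exp (- t) * exp_taylor c n t) <= K / t.
Proof.
  induction n as [|n (K & HK)].
  - exists 0. intros t Ht. unfold exp_taylor. simpl.
    rewrite Rmult_0_r, Rabs_R0. unfold Rdiv. lra.
  - destruct (exp_pow_bound (S n) 1 Rlt_0_1) as (K' & HK0 & HK').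
    exists (K + Rabs (exp_coef c n) * K'). intros t Ht.
    unfold exp_taylor in *. simpl psum. rewrite Rmult_plus_distr_l.
    eapply Rle_trans; [apply Rabs_triang|].
    unfold Rdiv. rewrite Rmult_plus_distr_r.
    apply Rplus_le_compat; [apply HK, Ht|].
    replace (exp (- t) * (exp_coef c n * t ^ n))
      with (exp_coef c n * (t ^ n * exp (- t))) by ring.
    rewrite Rabs_mult, Rmult_assoc. apply Rmult_le_compat_l; [apply Rabs_pos|].
    rewrite Rabs_right.
    + specialize (HK' t ltac:(lra)). replace (- (1) * t) with (- t) in HK' by ring.
      simpl pow in HK'. apply (Rmult_le_reg_r t); [lra|].
      rewrite (Rmult_assoc K'), Rinv_l by lra. lra.
    + apply Rle_ge, Rmult_le_pos; [apply pow_le; lra|left; apply exp_pos].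
Qed.

Lemma reg_exp_int j x : 0 < x -> is_int_pos (reg_exp j x) (reg_value j x).
Proof.
  intros Hx. induction j as [|j IH].
  - replace (reg_value 0 x) with (- ln x)
      by (unfold reg_value; simpl; field).
    generalize (frullani_exp x Hx). apply is_int_pos_ext. intros t Ht.
    unfold reg_exp, exp_taylor, exp_coef. simpl. field. lra.
  - set (T1 := exp_taylor (1 - x) (S j)). set (T2 := exp_taylor (1 - x) (S (S j))).
    set (E := fun t => exp (- x * t) - exp (- t) * T2 t).
    set (cj := exp_coef (1 - x) (S j)).
    assert (Hj : INR (S j) <> 0) by (apply not_0_INR; lia).
    assert (DT2 : forall t, is_derive T2 t ((1 - x) * T1 t))
      by (intros; apply is_derive_exp_taylor).
    assert (ET2 : forall t, T2 t = T1 t + cj * t ^ S j) by reflexivity.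
    assert (DT1 : forall t, ex_derive T1 t)
      by (intros; eexists; apply is_derive_exp_taylor).
    set (F := fun t => / t ^ S j * E t).
    (* This is the derivative of [F]: as T2' = (1 - x) T1 and T2 = T1 + cj t^(j+1), one has E' = - x
       (exp (- x t) - exp (- t) T1) + cj t^(j+1) exp (- t). *)
    set (f := fun t => - INR (S j) * reg_exp (S j) x t + - x * reg_exp j x t
                       + cj * (t ^ 0 * exp (- (1) * t))).
    assert (HF : is_int_pos f (0 - 0)).
    { apply (is_int_pos_derive F).
      - intros t Ht. unfold F, E. auto_derive.
        + split; [apply Rmult_integral_contrapositive; split;
            [lra|apply pow_nonzero; lra]|]. split; [eexists; apply DT2|trivial].
        + change (Derive (fun x0 => T2 x0) t) with (Derive T2 t).
          rewrite (is_derive_unique _ _ _ (DT2 t)).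
          change (match j with O => 1 | S _ => INR j + 1 end) with (INR (S j)).
          unfold f, reg_exp. fold T1 T2. rewrite ET2.
          replace (- (1) * t) with (- t) by ring.
          cbn [pow]. change (pred (S j)) with j.
          field. split; [apply pow_nonzero; lra|lra].
      - intros t Ht. unfold f, reg_exp. fold T1 T2. auto_derive.
        assert (0 < t ^ j) by (apply pow_lt, Ht).
        repeat match goal with |- _ /\ _ => split end;
          match goal with
          | |- ex_derive _ _ => first [apply DT1 | eexists; apply DT2]
          | |- _ <> 0 => apply Rgt_not_eq; repeat apply Rmult_lt_0_compat; assumption
          | |- True => exact Logic.I
          end.
      (* [E] is exp (- t) times a Taylor remainder of order j + 2, so F = O(t). *)
      - destruct (has_pseries_taylor _ _ (S (S j)) (has_pseries_exp (1 - x)))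
          as (K & r & HK).
        apply filterlim_at_right_0 with K r. intros t Ht. rewrite Rminus_0_r.
        specialize (HK t). rewrite (Rabs_right t) in HK by lra.
        specialize (HK Ht). fold (exp_taylor (1 - x) (S (S j)) t) in HK. fold T2 in HK.
        unfold F, E.
        replace (exp (- x * t)) with (exp (- t) * exp ((1 - x) * t))
          by (rewrite <- exp_plus; f_equal; ring).
        replace (/ t ^ S j * (exp (- t) * exp ((1 - x) * t) - exp (- t) * T2 t))
          with (exp (- t) * (/ t ^ S j * (exp ((1 - x) * t) - T2 t))) by ring.
        assert (0 < / t ^ S j) by (apply Rinv_0_lt_compat, pow_lt; lra).
        rewrite Rabs_mult, (Rabs_right (exp _)) by (apply Rle_ge, Rlt_le, exp_pos).
        apply Rle_trans with (1 * Rabs (/ t ^ S j * (exp ((1 - x) * t) - T2 t))).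
        { apply Rmult_le_compat_r; [apply Rabs_pos|]. rewrite <- exp_0.
          left. apply exp_increasing. lra. }
        rewrite Rmult_1_l, Rabs_mult, Rabs_right by lra.
        apply (Rmult_le_reg_l (t ^ S j)); [apply pow_lt; lra|].
        rewrite <- Rmult_assoc, Rinv_r, Rmult_1_l by (apply pow_nonzero; lra).
        replace (t ^ S j * (K * t)) with (K * t ^ S (S j)) by (simpl; ring).
        exact HK.
      - destruct (exp_taylor_decay (1 - x) (S (S j))) as (K & HK).
        destruct (exp_pow_bound 1 x Hx) as (K' & _ & HK').
        apply filterlim_p_infty_inv with (K' + K). intros t Ht. rewrite Rminus_0_r.
        unfold F. assert (Hp : 1 <= t ^ S j) by (apply pow_R1_Rle; lra).
        rewrite Rabs_mult, (Rabs_right (/ t ^ S j))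
          by (apply Rle_ge, Rlt_le, Rinv_0_lt_compat; lra).
        apply Rle_trans with (1 * Rabs (E t)).
        { apply Rmult_le_compat_r; [apply Rabs_pos|].
          rewrite <- Rinv_1. apply Rinv_le_contravar; lra. }
        rewrite Rmult_1_l. unfold E, Rminus.
        eapply Rle_trans; [apply Rabs_triang|]. rewrite Rabs_Ropp.
        unfold Rdiv. rewrite Rmult_plus_distr_r.
        apply Rplus_le_compat; [|apply HK, Ht].
        rewrite Rabs_right by (apply Rle_ge, Rlt_le, exp_pos).
        apply (Rmult_le_reg_r t); [lra|]. rewrite (Rmult_assoc K'), Rinv_l by lra.
        specialize (HK' t ltac:(lra)). simpl in HK'. lra. }
    assert (He := is_int_pos_exp_pow 1 0 Rlt_0_1).
    rewrite reg_value_S. fold cj.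
    replace (/ INR (S j) * (- x * reg_value j x + cj))
      with (/ INR (S j) * (- x * reg_value j x + cj * (INR (fact 0) / 1 ^ 1)
              + -1 * (0 - 0))).
    2:{ simpl (INR (fact 0)). rewrite pow1. field. exact Hj. }
    apply is_int_pos_ext with (fun t => / INR (S j) *
      (- x * reg_exp j x t + cj * (t ^ 0 * exp (- (1) * t)) + -1 * f t)).
    { intros t Ht. unfold f. field. exact Hj. }
    apply is_int_pos_scal. apply is_int_pos_plus; [apply is_int_pos_plus|].
    + apply is_int_pos_scal, IH.
    + apply is_int_pos_scal, He.
    + apply is_int_pos_scal, HF.
Qed.

(** The Taylor bounds are assumed on the whole half-line, so they can be integrated against exp (-
    lam t) without splitting the range. Keeping [K] in the conclusion makes the error bound uniform
    in [lam]. *)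
Lemma watson (rho : R -> R) (d : nat -> R) :
  (forall t, 0 < t -> continuous rho t) ->
  (forall L, exists K, forall t, 0 < t ->
     Rabs (rho t - psum (fun l => d l * t ^ l) L) <= K * t ^ L) ->
  exists W : R -> R, forall lam, 0 < lam ->
    is_int_pos (fun t => rho t * exp (- lam * t)) (W lam) /\
    forall L K, (forall t, 0 < t ->
     Rabs (rho t - psum (fun l => d l * t ^ l) L) <= K * t ^ L) ->
     Rabs (W lam - psum (fun l => d l * (INR (fact l) / lam ^ S l)) L)
       <= K * (INR (fact L) / lam ^ S L).
Proof.
  intros Cr HL.
  assert (Main : forall lam, 0 < lam -> forall L K, (forall t, 0 < t ->
     Rabs (rho t - psum (fun l => d l * t ^ l) L) <= K * t ^ L) ->
     exists l, is_int_pos (fun t => rho t * exp (- lam * t)) l /\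
     Rabs (l - psum (fun l => d l * (INR (fact l) / lam ^ S l)) L)
       <= K * (INR (fact L) / lam ^ S L)).
  { intros lam Hl L K HK.
    set (P := fun t => psum (fun l => d l * t ^ l) L).
    assert (CP : forall t, continuous P t).
    { intros t. unfold P. clear HK. induction L as [|L IH]; simpl;
        [apply continuous_const|].
      apply (continuous_plus (fun t => psum (fun l => d l * t ^ l) L)); [exact IH|].
      apply (ex_derive_continuous (fun t => d L * t ^ L)). auto_derive. trivial. }
    assert (Ce : forall t, continuous (fun t => exp (- lam * t)) t).
    { intros t. apply (ex_derive_continuous (fun t => exp (- lam * t))).
      auto_derive. trivial. }
    destruct (is_int_pos_dominated
      (fun t => (rho t - P t) * exp (- lam * t))
      (fun t => K * (t ^ L * exp (- lam * t)))
      (K * (INR (fact L) / lam ^ S L))) as (l & Hl1 & Hl2).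
    - intros t Ht. apply (continuous_mult (fun t => rho t - P t)); [|apply Ce].
      apply (continuous_minus rho P); [apply Cr, Ht|apply CP].
    - intros t Ht.
      apply (ex_derive_continuous (fun t => K * (t ^ L * exp (- lam * t)))).
      auto_derive. trivial.
    - intros t Ht. rewrite Rabs_mult, (Rabs_right (exp _))
        by (apply Rle_ge, Rlt_le, exp_pos).
      rewrite <- Rmult_assoc. apply Rmult_le_compat_r; [left; apply exp_pos|].
      apply HK, Ht.
    - apply is_int_pos_scal, is_int_pos_exp_pow, Hl.
    - set (S0 := psum (fun l => d l * (INR (fact l) / lam ^ S l)) L).
      exists (l + S0). split.
      + apply is_int_pos_ext with (fun t => (rho t - P t) * exp (- lam * t)
          + psum (fun l => d l * (t ^ l * exp (- lam * t))) L).
        * intros t Ht. unfold P.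
          rewrite (psum_ext (fun l => d l * (t ^ l * exp (- lam * t)))
            (fun l => exp (- lam * t) * (d l * t ^ l))) by (intros; ring).
          rewrite psum_scal. ring.
        * apply is_int_pos_plus; [exact Hl1|].
          apply (is_int_pos_psum (fun l t => d l * (t ^ l * exp (- lam * t)))).
          intros k _. apply is_int_pos_scal, is_int_pos_exp_pow, Hl.
      + replace (l + S0 - S0) with l by ring. exact Hl2. }
  exists (fun lam => RInt_gen (fun t => rho t * exp (- lam * t))
            (at_right 0) (Rbar_locally p_infty)).
  intros lam Hl.
  assert (U := RInt_gen_int_pos (fun t => rho t * exp (- lam * t))).
  split.
  (* Order 0 says that [rho] is bounded, which is enough for convergence. *)
  - destruct (HL 0%nat) as [K HK].
    destruct (Main lam Hl 0%nat K HK) as (l & H & _). rewrite (U l H). exact H.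
  - intros L K HK. destruct (Main lam Hl L K HK) as (l & H & H'). rewrite (U l H).
    exact H'.
Qed.

(** * A single residue class *)

(** Truncating the second factor at an order that depends on the first index leaves exactly the
    terms of total degree below [N]. This is why the expansion of [g] meets regularised exponentials
    of decreasing orders. *)
Lemma truncated_product (q c : nat -> R) t N :
  psum (fun i => q i * t ^ i * psum (fun l => c l * t ^ l) (N - i)) N
  = psum (fun k => PS_mult q c k * t ^ k) N.
Proof.
  induction N as [|N IH]; [reflexivity|].
  cbn [psum]. rewrite <- IH.
  rewrite (psum_ext _ (fun i => q i * t ^ i * psum (fun l => c l * t ^ l) (N - i)
      + t ^ N * (q i * c (N - i)%nat))).
  - rewrite psum_plus, psum_scal, PS_mult_psum. cbn [psum].
    replace (S N - N)%nat with 1%nat by lia. rewrite Nat.sub_diag. simpl. ring.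
  - intros i Hi. replace (S N - i)%nat with (S (N - i)) by lia. cbn [psum].
    replace (t ^ N) with (t ^ i * t ^ (N - i)) by (rewrite <- pow_add; f_equal; lia).
    ring.
Qed.

Lemma has_pseries_psum (a : nat -> nat -> R) (f : nat -> R -> R) n :
  (forall k, has_pseries (a k) (f k)) ->
  has_pseries (fun i => psum (fun k => a k i) n) (fun t => psum (fun k => f k t) n).
Proof.
  intros H. induction n as [|n IH].
  - generalize (has_pseries_scal 0 _ _ (H 0%nat)). intros H0.
    apply has_pseries_coef_ext with (fun i => 0 * a 0%nat i); [intros; simpl; ring|].
    revert H0. apply has_pseries_ext. intros; simpl; ring.
  - apply (has_pseries_plus (fun i => psum (fun k => a k i) n) (a n)
             (fun t => psum (fun k => f k t) n) (f n)); auto.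
Qed.

Lemma expands_psum J (u : nat -> nat -> R) (c : nat -> R) n :
  (forall k, (k < n)%nat -> expands J (fun s => RtoC (u k s)) (RtoC (c k))) ->
  expands J (fun s => RtoC (psum (fun k => u k s) n)) (RtoC (psum c n)).
Proof.
  induction n as [|n IH]; intros H.
  - apply (expands_poly_0 J (fun _ => 0)).
    apply poly_lt_le with 1%nat; [lia|apply poly_lt_const].
  - apply expands_ext with
      (fun s => RtoC (psum (fun k => u k s) n) + RtoC (u n s))%C.
    { intros s _. rewrite <- RtoC_plus. reflexivity. }
    cbn [psum]. rewrite RtoC_plus. apply expands_plus; [apply IH|]; auto.
Qed.

Lemma expands_scal_R J k (u : nat -> R) c :
  expands J (fun s => RtoC (u s)) (RtoC c) ->
  expands J (fun s => RtoC (k * u s)) (RtoC (k * c)).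
Proof.
  intros H. rewrite RtoC_mult. generalize (expands_scal J (RtoC k) _ _ H).
  apply expands_ext. intros. symmetry. apply RtoC_mult.
Qed.

Lemma expands_plus_R J (u v : nat -> R) c d :
  expands J (fun s => RtoC (u s)) (RtoC c) ->
  expands J (fun s => RtoC (v s)) (RtoC d) ->
  expands J (fun s => RtoC (u s + v s)) (RtoC (c + d)).
Proof.
  intros H H'. rewrite RtoC_plus. generalize (expands_plus J _ _ _ _ H H').
  apply expands_ext. intros. symmetry. apply RtoC_plus.
Qed.

Lemma reg_poly_poly j : poly_lt (S j) (reg_poly j).
Proof.
  induction j as [|j IH]; [apply (poly_lt_const 0)|].
  cbn [reg_poly]. apply poly_lt_scal, poly_lt_plus.
  - apply poly_lt_ext with (fun x => -1 * (x * reg_poly j x)); [intros; ring|].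
    apply poly_lt_scal, poly_lt_mul_id, IH.
  - apply poly_lt_ext with (fun x => / INR (fact (S j)) * (-1 * x + 1) ^ S j).
    { intros x. unfold exp_coef, Rdiv. rewrite Rmult_comm.
      replace (-1 * x + 1) with (1 - x) by ring. reflexivity. }
    apply poly_lt_scal, poly_lt_affine_pow.
Qed.

Lemma reg_poly_0_S j : reg_poly (S j) 0 = / (INR (S j) * INR (fact (S j))).
Proof.
  cbn [reg_poly]. unfold exp_coef. rewrite Rminus_0_r, pow1, Rinv_mult.
  unfold Rdiv. ring.
Qed.

(** Since ln (M s) = ln M + ln s, the term (M s)^j ln M reaches the constant only for j = 0, where
    its coefficient is -1. *)
Lemma expands_reg_value J M j :
  0 < M -> (j <= J)%nat ->
  expands J (fun s => RtoC (reg_value j (M * INR s)))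
    (RtoC (reg_poly j 0 + - ln M * (match j with O => 1 | S _ => 0 end))).
Proof.
  intros HM Hj. set (k := (-1) ^ (j + 1) / INR (fact j)).
  apply expands_ext with (fun s => RtoC (k * M ^ j * (INR s ^ j * ln (INR s))
     + (k * (ln M * (M * INR s + 0) ^ j) + reg_poly j (M * INR s + 0)))).
  { intros s Hs. f_equal. unfold reg_value. fold k.
    rewrite !Rplus_0_r, ln_mult, Rpow_mult_distr by
      (try exact HM; apply lt_0_INR; lia). ring. }
  set (P := fun x => k * (ln M * (M * x + 0) ^ j) + reg_poly j (M * x + 0)).
  replace (reg_poly j 0 + - ln M * (match j with O => 1 | S _ => 0 end))
    with (k * M ^ j * 0 + P 0).
  - apply (expands_plus_R J (fun s => k * M ^ j * (INR s ^ j * ln (INR s)))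
             (fun s => P (INR s))).
    + apply expands_scal_R, expands_log, Hj.
    + apply expands_poly_0, poly_lt_le with (S j); [lia|].
      apply poly_lt_plus.
      * do 2 apply poly_lt_scal. apply poly_lt_affine_pow.
      * apply (poly_lt_comp_affine (S j) M 0), reg_poly_poly.
  - unfold P, k. replace (M * 0 + 0) with 0 by ring.
    destruct j; [simpl; field|cbn [pow]; ring].
Qed.

Section Residue_class.

Variables M alpha : R.
Hypothesis M_pos : 0 < M.
Hypothesis alpha_pos : 0 < alpha.

(** For t > 0, the sum over k >= 0 of exp ((c - M k) t). With c = - alpha this is the function [g]
    of the class, with c = 1 - alpha it is exp t * g t. *)
Definition gen_exp (c t : R) : R := exp (c * t) / (1 - exp (- M * t)).

Lemma gen_exp_den t : t <> 0 -> 1 - exp (- M * t) <> 0.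
Proof.
  intros Ht E. assert (Hx : exp (- M * t) = exp 0) by (rewrite exp_0; lra).
  apply exp_inv in Hx. apply Ht. apply (Rmult_eq_reg_l M); lra.
Qed.

Lemma gen_exp_shift c d t : gen_exp (c + d) t = gen_exp c t * exp (d * t).
Proof.
  unfold gen_exp. rewrite Rmult_plus_distr_r, exp_plus. unfold Rdiv. ring.
Qed.

Lemma gen_exp_geometric c t s :
  t <> 0 ->
  gen_exp c t = psum (fun k => exp ((c - M * INR k) * t)) s
                + gen_exp (c - M * INR s) t.
Proof.
  intros Ht. induction s as [|s IH].
  - simpl. replace (c - M * 0) with c by ring. ring.
  - rewrite IH. cbn [psum]. rewrite Rplus_assoc. f_equal.
    replace (c - M * INR (S s)) with (c - M * INR s + - M)
      by (rewrite S_INR; ring).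
    rewrite gen_exp_shift. unfold gen_exp. field. apply gen_exp_den, Ht.
Qed.

Lemma has_pseries_gen_exp v c :
  has_pseries v (fun t => t / (1 - exp (- M * t))) ->
  has_pseries (PS_mult v (exp_coef c)) (fun t => t * gen_exp c t).
Proof.
  intros Hv. generalize (has_pseries_mult _ _ _ _ Hv (has_pseries_exp c)).
  apply has_pseries_ext. intros t Ht. unfold gen_exp, Rdiv. ring.
Qed.

Variables p q : nat -> R.
Hypothesis Hp : has_pseries p (fun t => t * gen_exp (1 - alpha) t).
Hypothesis Hq : has_pseries q (fun t => t * gen_exp (- alpha) t).

Lemma coef_shift n : q n = PS_mult p (exp_coef (-1)) n.
Proof.
  apply (has_pseries_unique _ _ _ Hq).
  generalize (has_pseries_mult _ _ _ _ Hp (has_pseries_exp (-1))).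
  apply has_pseries_ext. intros t _.
  rewrite Rmult_assoc, <- gen_exp_shift. do 2 f_equal. ring.
Qed.

(** Coefficient form of [gen_exp_geometric] at c = 1 - alpha: the subtracted Laurent polynomial has
    to be split in the same way as the function itself. *)
Lemma coef_geometric s i :
  p i = psum (fun k => PS_incr_1 (exp_coef (1 - (M * INR k + alpha))) i) s
        + PS_mult q (exp_coef (1 - M * INR s)) i.
Proof.
  apply (has_pseries_unique _ (fun i =>
    psum (fun k => PS_incr_1 (exp_coef (1 - (M * INR k + alpha))) i) s
        + PS_mult q (exp_coef (1 - M * INR s)) i) _ Hp).
  generalize (has_pseries_plus _ _ _ _
    (has_pseries_psum (fun k => PS_incr_1 (exp_coef (1 - (M * INR k + alpha)))) _ s
       (fun k => has_pseries_mul_id _ _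
                   (has_pseries_exp (1 - (M * INR k + alpha)))))
    (has_pseries_mult _ _ _ _ Hq (has_pseries_exp (1 - M * INR s)))).
  apply has_pseries_ext. intros t Ht.
  rewrite psum_scal, Rmult_assoc, <- gen_exp_shift, (gen_exp_geometric (1 - alpha) t s Ht).
  rewrite Rmult_plus_distr_l. f_equal; f_equal.
  - apply psum_ext. intros k _. do 2 f_equal. ring.
  - f_equal. ring.
Qed.

(** The power series gives the bound near 0 only. Away from 0, the function and its Taylor
    polynomial are bounded by t^N separately; the bound B t used for the function explains the
    condition 1 <= N. *)
Lemma gen_exp_taylor N :
  (1 <= N)%nat -> exists K, forall t, 0 < t ->
    Rabs (t * gen_exp (- alpha) t - psum (fun i => q i * t ^ i) N) <= K * t ^ N.
Proof.
  intros HN.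
  destruct (has_pseries_taylor _ _ N Hq) as (K1 & r & H1).
  assert (Hr := cond_pos r). set (dl := r / 2). assert (Hd : 0 < dl) by (unfold dl; lra).
  assert (H2 : exists K2, forall t, dl <= t ->
    Rabs (psum (fun i => q i * t ^ i) N) <= K2 * t ^ N).
  { clear HN H1. induction N as [|N (K & HK)].
    - exists 0. intros t Ht. simpl. rewrite Rabs_R0. lra.
    (* For t >= dl, t^N is at most t^(N+1) / dl. *)
    - exists ((K + Rabs (q N)) / dl). intros t Ht. cbn [psum].
      eapply Rle_trans; [apply Rabs_triang|].
      assert (HtN : 0 <= t ^ N) by (apply pow_le; lra).
      rewrite Rabs_mult, (Rabs_right (t ^ N)) by lra.
      apply Rle_trans with ((K + Rabs (q N)) * t ^ N).
      { rewrite Rmult_plus_distr_r. specialize (HK t Ht). lra. }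
      assert (H0 : 0 <= (K + Rabs (q N)) * t ^ N).
      { specialize (HK t Ht). generalize (Rabs_pos (psum (fun i => q i * t ^ i) N)).
        generalize (Rmult_le_pos _ _ (Rabs_pos (q N)) HtN). lra. }
      replace ((K + Rabs (q N)) / dl * t ^ S N)
        with ((K + Rabs (q N)) * t ^ N * (t / dl)) by (simpl; field; lra).
      rewrite <- (Rmult_1_r ((K + Rabs (q N)) * t ^ N)) at 1.
      apply Rmult_le_compat_l; [exact H0|].
      apply (Rmult_le_reg_r dl); [exact Hd|].
      unfold Rdiv. rewrite (Rmult_assoc t), Rinv_l by lra. lra. }
  destruct H2 as (K2 & H2).
  set (B := / (1 - exp (- M * dl))).
  assert (HMd : 0 < M * dl) by (apply Rmult_lt_0_compat; lra).
  assert (HB0 : exp (- M * dl) < 1).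
  { rewrite <- exp_0. apply exp_increasing. lra. }
  assert (HB : 0 < B) by (apply Rinv_0_lt_compat; lra).
  set (K3 := B / dl ^ (N - 1)).
  assert (H3 : forall t, dl <= t -> Rabs (t * gen_exp (- alpha) t) <= K3 * t ^ N).
  { intros t Ht.
    assert (HMt : M * dl <= M * t) by (apply Rmult_le_compat_l; lra).
    assert (Hden : 1 - exp (- M * dl) <= 1 - exp (- M * t)).
    { assert (exp (- M * t) <= exp (- M * dl)); [|lra].
      destruct (Req_dec t dl) as [->|Hn]; [lra|].
      left. apply exp_increasing.
      assert (M * dl < M * t) by (apply Rmult_lt_compat_l; lra). lra. }
    unfold gen_exp, Rdiv. rewrite !Rabs_mult.
    rewrite (Rabs_right t) by lra.
    rewrite (Rabs_right (exp _)) by (apply Rle_ge, Rlt_le, exp_pos).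
    rewrite (Rabs_right (/ _)) by (apply Rle_ge, Rlt_le, Rinv_0_lt_compat; lra).
    apply Rle_trans with (t * (1 * B)).
    - apply Rmult_le_compat_l; [lra|]. apply Rmult_le_compat.
      + left; apply exp_pos.
      + left; apply Rinv_0_lt_compat; lra.
      + rewrite <- exp_0. left. apply exp_increasing.
        assert (0 < alpha * t) by (apply Rmult_lt_0_compat; lra). lra.
      + apply Rinv_le_contravar; lra.
    - unfold K3. replace N with (S (N - 1)) at 2 by lia. simpl pow.
      assert (Hp1 : 0 < dl ^ (N - 1)) by (apply pow_lt, Hd).
      assert (Hp2 : dl ^ (N - 1) <= t ^ (N - 1)) by (apply pow_incr; lra).
      replace (B / dl ^ (N - 1) * (t * t ^ (N - 1)))
        with (t * B * (t ^ (N - 1) / dl ^ (N - 1))) by (field; lra).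
      rewrite Rmult_1_l, <- (Rmult_1_r (t * B)) at 1.
      apply Rmult_le_compat_l; [apply Rmult_le_pos; lra|].
      apply (Rmult_le_reg_r (dl ^ (N - 1))); [exact Hp1|].
      unfold Rdiv. rewrite (Rmult_assoc (t ^ (N - 1))), Rinv_l by lra. lra. }
  exists (Rmax K1 (K3 + K2)). intros t Ht.
  assert (HtN : 0 <= t ^ N) by (apply pow_le; lra).
  destruct (Rle_dec dl t) as [D|D].
  - apply Rle_trans with ((K3 + K2) * t ^ N).
    + unfold Rminus. eapply Rle_trans; [apply Rabs_triang|].
      rewrite Rabs_Ropp, Rmult_plus_distr_r.
      apply Rplus_le_compat; [apply H3, D|apply H2, D].
    + apply Rmult_le_compat_r; [exact HtN|apply Rmax_r].
  - apply Rle_trans with (K1 * t ^ N).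
    + specialize (H1 t). rewrite (Rabs_right t) in H1 by lra.
      apply H1. unfold dl in *. lra.
    + apply Rmult_le_compat_r; [exact HtN|apply Rmax_l].
Qed.

Variable n : nat.

(** The remainder of [g] after its Laurent terms up to t^n, divided by t^(n+1); its Taylor
    coefficients at 0 are q_(n+2), q_(n+3), ... *)
Definition laurent_rem (t : R) : R :=
  / t ^ (n + 2) * (t * gen_exp (- alpha) t - psum (fun i => q i * t ^ i) (n + 2)).

(** The integrand of the theorem for one class, with a factor [t] cleared: [p i] is the coefficient
    of t^(i-1), so the n + 2 terms are those of index -1, ..., n. *)
Definition integrand (t : R) : R :=
  / t ^ (n + 2) * exp (- t)
    * (t * gen_exp (1 - alpha) t - psum (fun i => p i * t ^ i) (n + 2)).

(** The function and its Laurent polynomial are both cut after [s] exponentials. In the tail g t *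
    exp (- M s t), each term of [g] of index at most [n] takes its share of the subtraction as a
    [reg_exp] at M s; the rest of [g] needs none. *)
Lemma integrand_split s t :
  0 < t ->
  integrand t =
    psum (fun k => reg_exp n (M * INR k + alpha) t) s
    + PS_mult q (fun j => reg_exp j (M * INR s) t) (n + 1)
    + laurent_rem t * exp (- (M * INR s) * t).
Proof.
  intros Ht.
  assert (Ht0 : t <> 0) by lra.
  assert (Htn : t ^ (n + 2) <> 0) by (apply pow_nonzero; lra).
  set (Q := psum (fun i => q i * t ^ i) (n + 2)).
  set (e := exp (- (M * INR s) * t)).
  set (Sx := psum (fun k => exp (- (M * INR k + alpha) * t)) s).
  set (A := psum (fun i =>
    psum (fun k => PS_incr_1 (exp_coef (1 - (M * INR k + alpha))) i) s * t ^ i) (n + 2)).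
  set (B := psum (fun i => PS_mult q (exp_coef (1 - M * INR s)) i * t ^ i) (n + 2)).
  assert (EP : psum (fun i => p i * t ^ i) (n + 2) = A + B).
  { unfold A, B. rewrite <- psum_plus. apply psum_ext. intros i _.
    rewrite (coef_geometric s i). ring. }
  assert (EG : t * gen_exp (- alpha) t = t * Sx + t * gen_exp (- alpha) t * e).
  { rewrite (gen_exp_geometric (- alpha) t s Ht0) at 1.
    replace (- alpha - M * INR s) with (- alpha + - (M * INR s)) by ring.
    rewrite gen_exp_shift. fold e. rewrite Rmult_plus_distr_l, <- Rmult_assoc.
    f_equal. f_equal. apply psum_ext. intros. do 2 f_equal. ring. }
  assert (EA : psum (fun k => reg_exp n (M * INR k + alpha) t) s
    = / t ^ (n + 2) * (t * Sx - exp (- t) * A)).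
  (* The factor [t] shifts the coefficients by one, so n + 2 of them leave a Taylor polynomial with
     n + 1 terms. *)
  { assert (EA' : A = t * psum (fun k => exp_taylor (1 - (M * INR k + alpha)) (S n) t) s).
    { unfold A. rewrite <- psum_scal. clear. induction s as [|s IH].
      - simpl psum. rewrite (psum_ext _ (fun i => 0 * 0)) by (intros; ring).
        rewrite psum_scal. ring.
      - cbn [psum]. rewrite <- IH.
        rewrite (psum_ext _ (fun i =>
          psum (fun k => PS_incr_1 (exp_coef (1 - (M * INR k + alpha))) i) s * t ^ i
          + PS_incr_1 (exp_coef (1 - (M * INR s + alpha))) i * t ^ i))
          by (intros; ring).
        rewrite psum_plus. f_equal.
        replace (n + 2)%nat with (1 + S n)%nat by lia. rewrite psum_add.
        unfold exp_taylor. rewrite <- psum_scal. simpl (psum _ 1).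
        change (@zero R_NormedModule) with 0.
        rewrite Rmult_0_l, !Rplus_0_l. apply psum_ext.
        intros i _. simpl. ring. }
    rewrite EA'. unfold Sx.
    rewrite (psum_ext _ (fun k => / t ^ S n * (exp (- (M * INR k + alpha) * t)
       - exp (- t) * exp_taylor (1 - (M * INR k + alpha)) (S n) t)))
      by reflexivity.
    rewrite psum_scal, psum_minus, psum_scal.
    replace (n + 2)%nat with (S (S n)) by lia. cbn [pow].
    field. split; [apply pow_nonzero; lra|lra]. }
  assert (EB : PS_mult q (fun j => reg_exp j (M * INR s) t) (n + 1)
    = / t ^ (n + 2) * (Q * e - exp (- t) * B)).
  { unfold B. rewrite <- truncated_product. unfold Q.
    rewrite PS_mult_psum, (Rmult_comm _ e), <- !psum_scal, <- psum_minus, <- psum_scal.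
    replace (S (n + 1)) with (n + 2)%nat by lia.
    apply psum_ext. intros i Hi. unfold reg_exp, exp_taylor. fold e.
    replace (S (n + 1 - i)) with (n + 2 - i)%nat by lia.
    replace (t ^ (n + 2)) with (t ^ i * t ^ (n + 2 - i))
      by (rewrite <- pow_add; f_equal; lia).
    field. split; apply pow_nonzero; lra. }
  rewrite EA, EB. unfold integrand, laurent_rem. rewrite EP. fold Q e.
  assert (EE : exp (- t) * (t * gen_exp (1 - alpha) t) = t * gen_exp (- alpha) t).
  { replace (1 - alpha) with (- alpha + 1) by ring. rewrite gen_exp_shift.
    replace (exp (- t) * (t * (gen_exp (- alpha) t * exp (1 * t))))
      with (t * gen_exp (- alpha) t * (exp (- t) * exp (1 * t))) by ring.
    rewrite <- exp_plus. replace (- t + 1 * t) with 0 by ring. rewrite exp_0. ring. }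
  rewrite Rmult_assoc, Rmult_minus_distr_l, EE, EG at 1. ring.
Qed.

Lemma residue_class_expansion :
  exists I, is_int_pos integrand I /\
    expands (n + 1)
      (fun s => RtoC (psum (fun k => (M * INR k + alpha) ^ n
                                      * ln (M * INR k + alpha)) s))
      (RtoC ((-1) ^ (n + 1) * INR (fact n) *
        (I - PS_mult p (fun j => (-1) ^ (j + 1) / INR (fact j) * harmonic j) (n + 1)
           + q (n + 1)%nat * ln M))).
Proof.
  set (sg := (-1) ^ (n + 1) * INR (fact n)).
  assert (HR : forall L, exists K, forall t, 0 < t ->
     Rabs (laurent_rem t - psum (fun l => q (n + 2 + l)%nat * t ^ l) L) <= K * t ^ L).
  { intros L. destruct (gen_exp_taylor (n + 2 + L) ltac:(lia)) as [K HK].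
    exists K. intros t Ht. specialize (HK t Ht).
    assert (Htn : 0 < t ^ (n + 2)) by (apply pow_lt; lra).
    apply (Rmult_le_reg_l (t ^ (n + 2))); [exact Htn|].
    rewrite <- (Rabs_right (t ^ (n + 2))) at 1 by lra.
    rewrite <- Rabs_mult.
    replace (t ^ (n + 2) * (K * t ^ L)) with (K * t ^ (n + 2 + L))
      by (rewrite pow_add; ring).
    eapply Rle_trans; [|exact HK]. apply Req_le. f_equal.
    rewrite psum_add. unfold laurent_rem.
    rewrite (psum_ext (fun i => q (n + 2 + i)%nat * t ^ (n + 2 + i))
      (fun i => t ^ (n + 2) * (q (n + 2 + i)%nat * t ^ i)))
      by (intros; rewrite pow_add; ring).
    rewrite psum_scal. field. lra. }
  destruct (watson laurent_rem (fun l => q (n + 2 + l)%nat)) as [W HW];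
    [|exact HR|].
  { intros t Ht. apply (ex_derive_continuous laurent_rem).
    unfold laurent_rem, gen_exp.
    assert (DP : forall N, ex_derive (fun t => psum (fun i => q i * t ^ i) N) t).
    { induction N as [|N IH]; simpl; [apply ex_derive_const|].
      apply (ex_derive_plus (fun t => psum (fun i => q i * t ^ i) N)); [exact IH|].
      auto_derive. trivial. }
    apply (ex_derive_mult (fun t => / t ^ (n + 2))).
    - auto_derive. apply pow_nonzero; lra.
    - apply (ex_derive_minus (fun t => t * (exp (- alpha * t) / (1 - exp (- M * t)))));
        [|apply DP].
      auto_derive. apply gen_exp_den. lra. }
  assert (Hx : forall k : nat, 0 < M * INR k + alpha).
  { intros k. generalize (Rmult_le_pos M (INR k) ltac:(lra) (pos_INR k)). lra. }
  (* [integrand] is free of [s]: all these values are equal, and this yields an exact formula for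
     the sum over the class. *)
  assert (HI : forall s, (1 <= s)%nat -> is_int_pos integrand
    (psum (fun k => reg_value n (M * INR k + alpha)) s
     + PS_mult q (fun j => reg_value j (M * INR s)) (n + 1) + W (M * INR s))).
  { intros s Hs. assert (HMs : 0 < M * INR s)
      by (apply Rmult_lt_0_compat; [exact M_pos|apply lt_0_INR; lia]).
    apply is_int_pos_ext with (fun t =>
      psum (fun k => reg_exp n (M * INR k + alpha) t) s
      + PS_mult q (fun j => reg_exp j (M * INR s) t) (n + 1)
      + laurent_rem t * exp (- (M * INR s) * t)).
    { intros t Ht. symmetry. apply integrand_split, Ht. }
    apply is_int_pos_plus; [apply is_int_pos_plus|apply HW, HMs].
    - apply (is_int_pos_psum (fun k => reg_exp n (M * INR k + alpha))).
      intros k _. apply reg_exp_int, Hx.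
    - rewrite PS_mult_psum.
      apply is_int_pos_ext with (fun t =>
        psum (fun i => q i * reg_exp (n + 1 - i) (M * INR s) t) (S (n + 1))).
      { intros t _. symmetry. apply PS_mult_psum. }
      apply (is_int_pos_psum (fun i t => q i * reg_exp (n + 1 - i) (M * INR s) t)).
      intros k _. apply is_int_pos_scal, reg_exp_int, HMs. }
  set (I := psum (fun k => reg_value n (M * INR k + alpha)) 1
     + PS_mult q (fun j => reg_value j (M * INR 1)) (n + 1) + W (M * INR 1)).
  assert (HI1 : is_int_pos integrand I) by (apply HI; lia).
  exists I. split; [exact HI1|].
  destruct (poly_lt_psum (S n) M alpha (reg_poly n) (reg_poly_poly n))
    as (F & HF & HF0 & EF).
  (* [sg] inverts the coefficient of x^n ln x in [reg_value n x]. *)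
  assert (Hsg : sg * ((-1) ^ (n + 1) / INR (fact n)) = 1).
  { unfold sg. replace ((-1) ^ (n + 1) * INR (fact n) * ((-1) ^ (n + 1) / INR (fact n)))
      with ((-1) ^ (n + 1) * (-1) ^ (n + 1))
      by (field; apply INR_fact_neq_0).
    rewrite <- pow_add. replace (n + 1 + (n + 1))%nat with (2 * (n + 1))%nat by lia.
    apply pow_1_even. }
  apply expands_ext with (fun s => RtoC (sg * (I + -1 *
     (F (INR s) + (PS_mult q (fun j => reg_value j (M * INR s)) (n + 1)
                   + W (M * INR s)))))).
  { intros s Hs. f_equal.
    rewrite (is_int_pos_unique _ _ _ HI1 (HI s Hs)), <- EF.
    unfold reg_value at 1. rewrite psum_plus, psum_scal.
    match goal with |- sg * (?c * ?u + ?a + ?b + ?w + -1 * (?a + (?b + ?w))) = _ =>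
      replace (sg * (c * u + a + b + w + -1 * (a + (b + w)))) with (sg * c * u) by ring
    end.
    rewrite Hsg. ring. }
  apply expands_scal_R.
  set (kap := fun j => reg_poly j 0 + - ln M * (match j with O => 1 | S _ => 0 end)).
  replace (I - PS_mult p (fun j => (-1) ^ (j + 1) / INR (fact j) * harmonic j) (n + 1)
           + q (n + 1)%nat * ln M)
    with (I + -1 * (0 + (PS_mult q kap (n + 1) + 0))).
  (* With q = p * exp_coef (-1) as a Cauchy product, associativity moves the exponential onto the
     constants [reg_poly j 0], which become the harmonic weights; the ln M term keeps its [q]. *)
  2:{ unfold kap. rewrite PS_mult_plus_r, PS_mult_scal_r, PS_mult_one_r.
      rewrite (PS_mult_ext q (PS_mult p (exp_coef (-1)))
                 (fun j => reg_poly j 0) (fun j => reg_poly j 0) (n + 1))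
        by (intros; first [reflexivity|apply coef_shift]).
      rewrite PS_mult_assoc.
      rewrite (PS_mult_ext p p (PS_mult (exp_coef (-1)) (fun j => reg_poly j 0))
        (fun j => (-1) ^ (j + 1) / INR (fact j) * harmonic j) (n + 1)).
      - ring.
      - reflexivity.
      - intros k _. apply exp_coef_mult_recip_index; [reflexivity|apply reg_poly_0_S]. }
  apply (expands_plus_R _ (fun _ => I)).
  { apply (expands_poly_0 _ (fun _ => I)).
    apply poly_lt_le with 1%nat; [lia|apply poly_lt_const]. }
  apply expands_scal_R. apply expands_plus_R; [|apply expands_plus_R].
  - rewrite <- HF0. apply expands_poly_0.
    replace (S (n + 1)) with (S (S n)) by lia. exact HF.
  - rewrite PS_mult_psum.
    apply expands_ext with (fun s => RtoC
      (psum (fun i => q i * reg_value (n + 1 - i) (M * INR s)) (S (n + 1)))).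
    { intros s _. f_equal. symmetry. apply PS_mult_psum. }
    apply expands_psum. intros k Hk. apply expands_scal_R.
    apply expands_reg_value; [exact M_pos|lia].
  - apply (expands_tail (n + 1) (fun s => W (M * INR s))
      (fun l => q (n + 2 + l)%nat * INR (fact l) / M ^ S l)).
    intros L. destruct (HR L) as [K HK].
    exists (K * INR (fact L) / M ^ S L). intros s Hs.
    assert (Hs0 : 0 < INR s) by (apply lt_0_INR; lia).
    assert (HMs : 0 < M * INR s) by (apply Rmult_lt_0_compat; lra).
    destruct (HW _ HMs) as [_ HW2]. specialize (HW2 L K HK).
    rewrite (psum_ext _ (fun l => q (n + 2 + l)%nat
               * (INR (fact l) / (M * INR s) ^ S l))).
    + eapply Rle_trans; [exact HW2|]. apply Req_le.
      rewrite Rpow_mult_distr. field. split; apply pow_nonzero; lra.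
    + intros l _. rewrite Rpow_mult_distr. field. split; apply pow_nonzero; lra.
Qed.

End Residue_class.

(** * Periodic sequences *)

Definition csum (f : nat -> C) (m : nat) : C := sum_n_m f 1 m.

Lemma csum_0 f : csum f 0 = RtoC 0.
Proof. unfold csum. rewrite sum_n_m_zero by lia. reflexivity. Qed.

Lemma csum_S f m : csum f (S m) = (csum f m + f (S m))%C.
Proof. unfold csum. rewrite sum_n_Sm by lia. reflexivity. Qed.

Lemma csum_ext f g m :
  (forall a, (1 <= a <= m)%nat -> f a = g a) -> csum f m = csum g m.
Proof. intros H. apply sum_n_m_ext_loc. exact H. Qed.

Lemma csum_add f k m :
  csum f (k + m) = (csum f k + csum (fun a => f (k + a)%nat) m)%C.
Proof.
  induction m as [|m IH].
  - rewrite csum_0, Nat.add_0_r. ring.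
  - rewrite Nat.add_succ_r, !csum_S, IH, Nat.add_succ_r. ring.
Qed.

Lemma csum_plus f g m : csum (fun a => f a + g a)%C m = (csum f m + csum g m)%C.
Proof.
  induction m as [|m IH]; [rewrite !csum_0; ring|rewrite !csum_S, IH; ring].
Qed.

Lemma csum_scal c f m : csum (fun a => c * f a)%C m = (c * csum f m)%C.
Proof.
  induction m as [|m IH]; [rewrite !csum_0; ring|rewrite !csum_S, IH; ring].
Qed.

Lemma csum_psum (c : nat -> C) (Q : nat -> R) (r : nat -> nat -> R) m N :
  csum (fun a => c a * RtoC (psum (fun j => Q j * r a j)%R (S N)))%C m
  = sum_n (fun j => RtoC (Q j) * csum (fun a => c a * RtoC (r a j))%C m)%C N.
Proof.
  assert (E : forall j, csum (fun a => c a * RtoC (Q j * r a j)%R)%C m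
     = (RtoC (Q j) * csum (fun a => c a * RtoC (r a j)) m)%C).
  { intros j. rewrite <- csum_scal. apply csum_ext. intros a _.
    rewrite RtoC_mult. ring. }
  induction N as [|N IH].
  - rewrite sum_O, <- E. apply csum_ext. intros a _. simpl. rewrite Rplus_0_l.
    reflexivity.
  - rewrite sum_Sn, <- IH, <- E. change plus with Cplus. rewrite <- csum_plus.
    apply csum_ext. intros a _. simpl psum. rewrite !RtoC_plus. ring.
Qed.

(** * Complex combinations: Laurent coefficients, integrals and expansions *)

Lemma is_series_linear {U V : NormedModule R_AbsRing} (l : U -> V) a s :
  is_linear l -> is_series a s -> is_series (fun n => l (a n)) (l s).
Proof.
  intros Hl H. unfold is_series.
  apply filterlim_ext with (fun n => l (sum_n a n)).
  - intros n. induction n as [|n IH].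
    + rewrite !sum_O. reflexivity.
    + rewrite !sum_Sn, (linear_plus l Hl), IH. reflexivity.
  - apply (filterlim_comp _ _ _ (sum_n a) l _ (locally s)); [exact H|].
    apply linear_cont, Hl.
Qed.

(** Multiplication by [t] and passage to real and imaginary parts reduce it to uniqueness of real
    power series. *)
Lemma is_laurent_unique f beta beta' i :
  is_laurent f beta -> is_laurent f beta' ->
  beta (Z.of_nat i - 1)%Z = beta' (Z.of_nat i - 1)%Z.
Proof.
  assert (K : forall (phi : C -> R) (b : Z -> C),
    @is_linear R_AbsRing C_R_NormedModule R_NormedModule phi ->
    (forall z r, phi (z * RtoC r)%C = phi z * r) ->
    is_laurent f b ->
    has_pseries (fun i => phi (b (Z.of_nat i - 1)%Z)) (fun t => t * phi (f t))).
  { intros phi b Hl Hs [r H]. exists r. intros t Ht.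
    assert (t <> 0) by (intros ->; rewrite Rabs_R0 in Ht; lra).
    apply is_pseries_R.
    generalize (is_series_scal t _ _ (is_series_linear phi _ _ Hl (H t Ht))).
    apply is_series_ext. intros k. rewrite Hs.
    change (t * (phi (b (Z.of_nat k - 1)%Z) * powerRZ t (Z.of_nat k - 1))
            = phi (b (Z.of_nat k - 1)%Z) * t ^ k).
    unfold Z.sub. rewrite powerRZ_add, <- pow_powerRZ by assumption.
    simpl. field. assumption. }
  intros H H'. apply injective_projections.
  - apply (has_pseries_unique _ _ _
      (K fst beta is_linear_fst ltac:(intros [x y] r; simpl; ring) H)
      (K fst beta' is_linear_fst ltac:(intros [x y] r; simpl; ring) H')).
  - apply (has_pseries_unique _ _ _
      (K snd beta is_linear_snd ltac:(intros [x y] r; simpl; ring) H)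
      (K snd beta' is_linear_snd ltac:(intros [x y] r; simpl; ring) H')).
Qed.

Lemma laurent_coef_eq f (c : nat -> C) i :
  is_laurent f (fun k => c (Z.to_nat (k + 1))) ->
  laurent_coef f (Z.of_nat i - 1) = c i.
Proof.
  intros H.
  assert (E : c (Z.to_nat (Z.of_nat i - 1 + 1)) = c i) by (f_equal; lia).
  unfold laurent_coef. apply (iota_unique (V := C_R_CompleteNormedModule)).
  - intros y (beta & Hb & ->). rewrite (is_laurent_unique _ _ _ i Hb H). exact E.
  - eexists. split; [exact H|]. symmetry. exact E.
Qed.

Lemma is_laurent_ext f g beta :
  (forall t, t <> 0 -> f t = g t) -> is_laurent f beta -> is_laurent g beta.
Proof.
  intros E [r H]. exists r. intros t Ht. rewrite <- E; [apply H, Ht|].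
  intros ->. rewrite Rabs_R0 in Ht. lra.
Qed.

Lemma is_laurent_csum (c : nat -> C) (p : nat -> nat -> R) (g : nat -> R -> R) m :
  (forall a, has_pseries (p a) (fun t => t * g a t)) ->
  is_laurent (fun t => csum (fun a => c a * RtoC (g a t))%C m)
    (fun k => csum (fun a => c a * RtoC (p a (Z.to_nat (k + 1))))%C m).
Proof.
  intros Hp. induction m as [|m IH].
  - exists (mkposreal 1 Rlt_0_1). intros t _. rewrite csum_0.
    apply (is_series_ext (fun _ => RtoC 0)).
    { intros i. rewrite csum_0.
      change (RtoC 0 = (RtoC 0 * RtoC (powerRZ t (Z.of_nat i - 1)))%C). ring. }
    unfold is_series. apply filterlim_ext with (fun _ : nat => RtoC 0);
      [|apply filterlim_const].
    intros k. symmetry. apply sum_n_C0.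
  - destruct IH as [r1 H1], (Hp (S m)) as [r2 H2].
    destruct (posreal_min3 r1 r2 r2) as (r & h1 & h2 & _).
    exists r. intros t Ht. rewrite csum_S.
    assert (t <> 0) by (intros ->; rewrite Rabs_R0 in Ht; lra).
    specialize (H1 t ltac:(lra)). specialize (H2 t ltac:(lra)).
    apply is_pseries_R in H2.
    assert (H3 := is_series_scal (/ t) _ _ H2).
    assert (H4 := is_series_linear (fun x : R => (c (S m) * RtoC x)%C) _ _
      (is_linear_comp _ _ is_linear_RtoC (is_linear_Cmult (c (S m)))) H3).
    change (scal (/ t) (t * g (S m) t)) with (/ t * (t * g (S m) t)) in H4.
    rewrite <- Rmult_assoc, Rinv_l, Rmult_1_l in H4 by assumption.
    assert (H5 := is_series_plus _ _ _ _ H1 H4).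
    revert H5. apply is_series_ext. intros i. rewrite csum_S.
    replace (Z.to_nat (Z.of_nat i - 1 + 1)) with i by lia.
    change (scal (/ t) (p (S m) i * t ^ i)) with (/ t * (p (S m) i * t ^ i)).
    change (@plus C_R_NormedModule) with Cplus.
    replace (powerRZ t (Z.of_nat i - 1)) with (/ t * t ^ i).
    + rewrite !RtoC_mult. Cring.
    + unfold Z.sub. rewrite powerRZ_add, <- pow_powerRZ by assumption.
      simpl. field. assumption.
Qed.

Lemma is_RInt_gen_csum (c : nat -> C) (g : nat -> R -> R) (l : nat -> R) m :
  (forall a, (1 <= a <= m)%nat -> is_int_pos (g a) (l a)) ->
  @is_RInt_gen C_R_NormedModule (fun t => csum (fun a => c a * RtoC (g a t))%C m)
    (at_right 0) (Rbar_locally p_infty) (csum (fun a => c a * RtoC (l a))%C m).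
Proof.
  (* The real integrals are pushed through the continuous linear map y -> k y, real and imaginary
     parts being treated separately on each segment. *)
  assert (K : forall (k : C) f I, is_int_pos f I ->
    @is_RInt_gen C_R_NormedModule (fun t => k * RtoC (f t))%C
      (at_right 0) (Rbar_locally p_infty) (k * RtoC I)%C).
  { intros k f I H P HP.
    assert (Hl := linear_cont (fun x : R => (k * RtoC x)%C) I
      (is_linear_comp _ _ is_linear_RtoC (is_linear_Cmult k))).
    generalize (H (fun y => P (k * RtoC y)%C) (Hl P HP)).
    unfold filtermapi. apply filter_imp. intros [a b] (y & Hy & Py). exists (k * RtoC y)%C.
    split; [|exact Py].
    replace (k * RtoC y)%C with (Re k * y, Im k * y)
      by (destruct k; apply injective_projections; simpl; ring).
    apply is_RInt_fct_extend_pair.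
    - apply (is_RInt_ext (fun t => Re k * f t));
        [|apply (is_RInt_scal f a b (Re k) y Hy)].
      intros t _. destruct k; simpl. ring.
    - apply (is_RInt_ext (fun t => Im k * f t));
        [|apply (is_RInt_scal f a b (Im k) y Hy)].
      intros t _. destruct k; simpl. ring. }
  induction m as [|m IH]; intros H.
  - rewrite csum_0. replace (RtoC 0) with (0 * RtoC 0)%C by ring.
    apply (is_RInt_gen_ext (V := C_R_NormedModule) (fun _ => 0 * RtoC 0)%C);
      [|apply (K 0%C _ _ is_int_pos_0)].
    apply filter_forall. intros [a b] t _. rewrite csum_0. Cring.
  - rewrite csum_S.
    apply (is_RInt_gen_ext (fun t => plus
      (csum (fun a => c a * RtoC (g a t))%C m) (c (S m) * RtoC (g (S m) t))%C)).
    + apply filter_forall. intros [a b] t _. rewrite csum_S. reflexivity.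
    + apply (is_RInt_gen_plus (V := C_R_NormedModule)
        (fun t => csum (fun a => c a * RtoC (g a t))%C m)).
      * apply IH. intros a Ha. apply H. lia.
      * apply K, H. lia.
Qed.

Lemma expands_csum J (c : nat -> C) (u : nat -> nat -> R) (l : nat -> R) m :
  (forall a, (1 <= a <= m)%nat -> expands J (fun s => RtoC (u a s)) (RtoC (l a))) ->
  expands J (fun s => csum (fun a => c a * RtoC (u a s))%C m)
    (csum (fun a => c a * RtoC (l a))%C m).
Proof.
  induction m as [|m IH]; intros H.
  - apply expands_ext with (fun _ => RtoC 0).
    { intros; rewrite csum_0; reflexivity. }
    rewrite csum_0. apply (expands_poly_0 J (fun _ => 0)).
    apply poly_lt_le with 1%nat; [lia|apply poly_lt_const].
  - apply expands_ext with (fun s => csum (fun a => c a * RtoC (u a s)) m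
      + c (S m) * RtoC (u (S m) s))%C.
    { intros; rewrite csum_S; reflexivity. }
    rewrite csum_S. apply expands_plus.
    + apply IH. intros a Ha. apply H. lia.
    + apply expands_scal, H. lia.
Qed.

(** The representatives run over 1, ..., m as in [F_chi], so every class has a positive first term
    and no logarithm of 0 occurs. *)
Lemma sum_residue_classes (m : nat) (chi : Z -> C) (f : R -> R) s :
  (forall k : Z, chi (k + Z.of_nat m)%Z = chi k) ->
  csum (fun k => chi (Z.of_nat k) * RtoC (f (INR k)))%C (m * s)
  = csum (fun a => chi (Z.of_nat a)
             * RtoC (psum (fun k => f (INR m * INR k + INR a)%R) s))%C m.
Proof.
  intros Hper. induction s as [|s IH].
  - rewrite Nat.mul_0_r, csum_0. simpl psum.
    rewrite (csum_ext _ (fun a => RtoC 0 * chi (Z.of_nat a))%C)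
      by (intros; ring).
    rewrite csum_scal. ring.
  - rewrite Nat.mul_succ_r, csum_add, IH, <- csum_plus. apply csum_ext. intros a _.
    assert (E : chi (Z.of_nat (m * s + a)) = chi (Z.of_nat a)).
    { clear IH. induction s as [|s IH]; [f_equal; lia|].
      rewrite <- IH, <- (Hper (Z.of_nat (m * s + a))). f_equal. lia. }
    rewrite E. cbn [psum]. rewrite plus_INR, mult_INR, RtoC_plus. ring.
Qed.

(** The two signs in - t / (exp (- m t) - 1) cancel. The value w = 0 leads to the coefficients [p],
    and w = 1 to [q]. *)
Lemma F_chi_gen_exp m chi t w :
  (1 <= m)%nat -> t <> 0 ->
  (F_chi m chi (- t) (w - 1) / RtoC t)%C
  = csum (fun a => chi (Z.of_nat a)
            * RtoC (gen_exp (INR m) (1 - w - INR a) t))%C m.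
Proof.
  intros Hm Ht. unfold Cdiv. rewrite Cmult_comm.
  unfold F_chi. fold (csum (fun a : nat =>
    (chi (Z.of_nat a)
       * RtoC (- t * exp (INR a * - t) / (exp (INR m * - t) - 1)
                 * exp ((w - 1) * - t))%R)%C) m).
  rewrite <- csum_scal. apply csum_ext. intros a _.
  assert (HM : 0 < INR m) by (apply lt_0_INR; lia).
  assert (Hd := gen_exp_den (INR m) HM t Ht).
  rewrite <- RtoC_inv by exact Ht.
  rewrite (Cmult_comm (RtoC (/ t))), <- Cmult_assoc, <- RtoC_mult. do 2 f_equal.
  unfold gen_exp.
  replace ((1 - w - INR a) * t) with (INR a * - t + (w - 1) * - t) by ring.
  rewrite exp_plus. replace (INR m * - t) with (- INR m * t) by ring.
  field. repeat split; try assumption. intros E. apply Hd. lra.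
Qed.

Lemma b_chi_eq m chi v w i :
  (1 <= m)%nat ->
  has_pseries v (fun t => t / (1 - exp (- INR m * t))) ->
  b_chi m chi (Z.of_nat i - 1) w
  = csum (fun a => chi (Z.of_nat a)
      * RtoC (PS_mult v (exp_coef (1 - w - INR a)) i))%C m.
Proof.
  intros Hm Hv.
  apply (laurent_coef_eq _ (fun i => csum (fun a => chi (Z.of_nat a)
      * RtoC (PS_mult v (exp_coef (1 - w - INR a)) i))%C m) i).
  generalize (is_laurent_csum (fun a => chi (Z.of_nat a))
    (fun a => PS_mult v (exp_coef (1 - w - INR a)))
    (fun a => gen_exp (INR m) (1 - w - INR a)) m
    (fun a => has_pseries_gen_exp (INR m) v (1 - w - INR a) Hv)).
  apply is_laurent_ext. intros t Ht. symmetry. apply F_chi_gen_exp; assumption.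
Qed.

(** Convergence of the integral is part of the conclusion, because [RInt_gen] denotes some value in
    any case. *)
Theorem theorem1p17 (m n : nat) (chi : Z -> C) (Hm : (1 <= m)%nat)
    (Hper : forall k : Z, chi (k + Z.of_nat m)%Z = chi k)
    (H0 : chi 0%Z = RtoC 0) :
  let f : R -> C := fun t : R =>
    (RtoC (/ t ^ n)
       * (F_chi m chi (- t) (-1) / RtoC t
          - sum_n (fun i : nat =>
              b_chi m chi (Z.of_nat i - 1) 0%R
                * RtoC (powerRZ t (Z.of_nat i - 1))) (n + 1))
       * RtoC (exp (- t) / t))%C in
  let sgn_fact : R := ((-1) ^ (n + 1) * INR (fact n))%R in
  @ex_RInt_gen C_R_NormedModule f (at_right 0%R) (Rbar_locally p_infty) /\
  S_hat n m chi =
    (RtoC sgn_fact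
       * @RInt_gen C_R_CompleteNormedModule f
           (at_right 0%R) (Rbar_locally p_infty)
     - RtoC sgn_fact
       * sum_n (fun j : nat =>
           RtoC ((-1) ^ (j + 1) / INR (fact j) * harmonic j)
             * b_chi m chi (Z.of_nat n - Z.of_nat j) 0%R) (n + 1)
     + RtoC sgn_fact * b_chi m chi (Z.of_nat n) 1%R * RtoC (ln (INR m)))%C.
Proof.
  intros f sgn_fact.
  assert (HM : 0 < INR m) by (apply lt_0_INR; lia).
  destruct (has_pseries_bernoulli (INR m) HM) as [v Hv].
  set (p := fun a => PS_mult v (exp_coef (1 - INR a))).
  set (q := fun a => PS_mult v (exp_coef (- INR a))).
  set (ch := fun a => chi (Z.of_nat a)).
  set (Q := fun j => (-1) ^ (j + 1) / INR (fact j) * harmonic j).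
  set (g := fun a => integrand (INR m) (INR a) (p a) n).
  set (I := fun a => RInt_gen (g a) (at_right 0) (Rbar_locally p_infty)).
  assert (Hclass : forall a, (1 <= a <= m)%nat ->
    is_int_pos (g a) (I a) /\
    expands (n + 1)
      (fun s => RtoC (psum (fun k => (INR m * INR k + INR a) ^ n
                                      * ln (INR m * INR k + INR a)) s))
      (RtoC (sgn_fact * (I a - PS_mult (p a) Q (n + 1)
                          + q a (n + 1)%nat * ln (INR m))))).
  { intros a Ha.
    destruct (residue_class_expansion (INR m) (INR a) HM ltac:(apply lt_0_INR; lia)
      (p a) (q a) (has_pseries_gen_exp _ _ _ Hv) (has_pseries_gen_exp _ _ _ Hv) n)
      as (I' & HI & HE).
    replace (I a) with I'; [split; assumption|].
    symmetry. exact (RInt_gen_int_pos (g a) I' HI). }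
  assert (Hb0 : forall i, b_chi m chi (Z.of_nat i - 1) 0
                 = csum (fun a => ch a * RtoC (p a i))%C m).
  { intros i. rewrite (b_chi_eq m chi v 0 i Hm Hv). apply csum_ext. intros a _.
    unfold ch, p. rewrite Rminus_0_r. reflexivity. }
  assert (Hb1 : b_chi m chi (Z.of_nat n) 1
                 = csum (fun a => ch a * RtoC (q a (n + 1)%nat))%C m).
  { replace (Z.of_nat n) with (Z.of_nat (n + 1) - 1)%Z by lia.
    rewrite (b_chi_eq m chi v 1 _ Hm Hv). apply csum_ext. intros a _.
    unfold ch, q. replace (1 - 1 - INR a) with (- INR a) by ring. reflexivity. }
  assert (Hint : @is_RInt_gen C_R_NormedModule f (at_right 0) (Rbar_locally p_infty)
            (csum (fun a => ch a * RtoC (I a))%C m)).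
  { apply (is_RInt_gen_ext (V := C_R_NormedModule)
      (fun t => csum (fun a => ch a * RtoC (g a t))%C m) f);
      [|exact (is_RInt_gen_csum ch g I m (fun a Ha => proj1 (Hclass a Ha)))].
    generalize filter_prod_pos. apply filter_imp.
    intros [x y]; simpl. intros [Hx Hy] t Ht. rewrite Rmin_left in Ht by lra.
    assert (Ht0 : t <> 0) by lra.
    unfold f. replace (-1) with (0 - 1) by ring.
    rewrite (F_chi_gen_exp m chi t 0 Hm Ht0).
    rewrite (sum_n_ext _ (fun i => RtoC (powerRZ t (Z.of_nat i - 1))
        * csum (fun a => ch a * RtoC (p a i)) m)%C)
      by (intros i; rewrite Hb0; Cring).
    rewrite <- (csum_psum ch (fun i => powerRZ t (Z.of_nat i - 1)) p).
    unfold Cminus. rewrite Cmult_plus_distr_l, Cmult_plus_distr_r.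
    match goal with |- _ = (?A * ?X * ?B + ?A * (- ?Y) * ?B)%C =>
      replace (A * X * B + A * (- Y) * B)%C
        with (A * B * X + RtoC (-1) * (A * B) * Y)%C
        by (destruct A, B, X, Y; apply injective_projections; simpl; ring) end.
    rewrite <- !csum_scal, <- csum_plus. apply csum_ext. intros a _.
    fold (ch a).
    match goal with |- (_ * RtoC ?G)%C = (RtoC ?A * RtoC ?B * (_ * RtoC ?X)
        + RtoC ?m1 * (RtoC ?A * RtoC ?B) * (_ * RtoC ?Y))%C =>
      replace G with (A * B * X + m1 * (A * B) * Y);
      [rewrite !RtoC_plus, !RtoC_mult; ring|] end.
    unfold g, integrand. rewrite Rminus_0_r.
    replace (S (n + 1)) with (n + 2)%nat by lia.
    rewrite (psum_ext (fun i => powerRZ t (Z.of_nat i - 1) * p a i)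
               (fun i => / t * (p a i * t ^ i))).
    - rewrite psum_scal, pow_add. simpl. field. split; [lra|apply pow_nonzero; lra].
    - intros i _. unfold Z.sub. rewrite powerRZ_add, <- pow_powerRZ by assumption.
      simpl. field. assumption. }
  split; [eexists; exact Hint|].
  rewrite (is_RInt_gen_unique (V := C_R_CompleteNormedModule) f _ Hint).
  unfold S_hat.
  rewrite (asymptotic_constant_eq (n + 1) _
    (csum (fun a => ch a * RtoC (sgn_fact * (I a - PS_mult (p a) Q (n + 1)
                          + q a (n + 1)%nat * ln (INR m))))%C m)).
  2:{ generalize (expands_csum (n + 1) ch _ _ m (fun a Ha => proj2 (Hclass a Ha))).
      apply expands_ext. intros s _. symmetry.
      apply (sum_residue_classes m chi (fun x => x ^ n * ln x) s Hper). }
  rewrite Hb1.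
  rewrite (sum_n_ext_loc _ (fun j => RtoC (Q j)
     * csum (fun a => ch a * RtoC (p a (n + 1 - j)%nat)) m)%C).
  (* The Laurent index n - j is (n + 1 - j) - 1, where the natural subtraction is exact for j <= n +
     1. *)
  2:{ intros j Hj. rewrite <- Hb0. unfold Q. do 2 f_equal. lia. }
  rewrite <- (csum_psum ch Q (fun a j => p a (n + 1 - j)%nat)).
  rewrite (csum_ext _ (fun a => RtoC sgn_fact * (ch a * RtoC (I a))
     + (RtoC (- sgn_fact) * (ch a * RtoC (PS_mult (p a) Q (n + 1)))
     + RtoC sgn_fact * RtoC (ln (INR m)) * (ch a * RtoC (q a (n + 1)%nat))))%C).
  2:{ intros a _. rewrite RtoC_mult, RtoC_plus, RtoC_minus, RtoC_opp, RtoC_mult. ring. }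
  rewrite !csum_plus, !csum_scal.
  rewrite (csum_ext (fun a => ch a * RtoC (PS_mult (p a) Q (n + 1)))%C
    (fun a => ch a * RtoC (psum (fun j => Q j * p a (n + 1 - j)%nat)%R (S (n + 1))))%C).
  2:{ intros a _. rewrite PS_mult_comm, PS_mult_psum. reflexivity. }
  rewrite RtoC_opp. ring.
Qed.
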